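(* Let $w\colon \mathbb{N}\times\mathbb{N}\to\mathbb{R}$ be a nonnegative function satisfying $\sup_{k\ge 0}\sum_{j=0}^{\infty}w(j,k)<\infty$. Then, for all $n\ge0$, it holds on $\mathrm{Dom}\,N$ that $$S_w\partial_n^*=\partial_n^*S_w-\partial_n^*N_{w(\cdot,n)}-\partial_n^*N_{w(n,\cdot)}+\Big(\sum_{j=0}^\infty w(j,n)\Big)\partial_n^*,$$ where $N_{w(\cdot,n)}$, $N_{w(n,\cdot)}$ are the 1D-weighted number operators associated with the functions $w(\cdot,n)$ and $w(n,\cdot)$, respectively.
   Context: $\mathbb{N}$ is the set of nonnegative integers and $\Gamma$ the set of all finite subsets of $\mathbb{N}$; $\mathbf{1}_\sigma$ is the indicator function of $\sigma\in\Gamma$ and $\#(\sigma)$ its cardinality. $(\Omega,\mathscr{F},\mathbb{P})$ is a probability space and $Z=(Z_n)_{n\ge0}$ an independent sequence of random variables with $\mathbb{P}\{Z_n=\theta_n\}=p_n$, $\mathbb{P}\{Z_n=-1/\theta_n\}=q_n$, where $0<p_n<1$, $q_n=1-p_n$, $\theta_n=\sqrt{q_n/p_n}$, and $\mathscr{F}$ is the $\sigma$-field generated by $Z$. $\mathsf{L}^2(Z)=L^2(\Omega,\mathscr{F},\mathbb{P})$ (complex-valued), with inner product $\langle\xi,\eta\rangle=\mathbb{E}[\overline{\xi}\eta]$. Put $Z_\emptyset=1$ and $Z_\sigma=\prod_{i\in\sigma}Z_i$; $\{Z_\sigma\mid\sigma\in\Gamma\}$ is an orthonormal basis of $\mathsf{L}^2(Z)$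 (the canonical ONB). For $k\in\mathbb{N}$, $\partial_k$ is the bounded operator on $\mathsf{L}^2(Z)$ with $\partial_kZ_\sigma=\mathbf{1}_\sigma(k)Z_{\sigma\setminus\{k\}}$, and its adjoint satisfies $\partial_k^*Z_\sigma=[1-\mathbf{1}_\sigma(k)]Z_{\sigma\cup\{k\}}$, for all $\sigma\in\Gamma$. A double series $\sum_{j,k=0}^\infty\xi_{jk}$ in $\mathsf{L}^2(Z)$ converges naturally if $s_n=\sum_{j=0}^n\sum_{k=0}^n\xi_{jk}$ converges in $\mathsf{L}^2(Z)$ as $n\to\infty$; its sum is then $\lim_n s_n$. For nonnegative $w$ with $\sup_{k\ge0}\sum_{j=0}^\infty w(j,k)<\infty$, the 2D-weighted number operator $S_w$ associated with $w$ is $S_w\xi=\sum_{j,k=0}^\infty w(j,k)\partial_k^*\partial_j\partial_j^*\partial_k\xi$, with domain $\mathrm{Dom}\,S_w$ the set of all $\xi\in\mathsf{L}^2(Z)$ for which this double series converges naturally. For bounded nonnegative $u\colon\mathbb{N}\to\mathbb{R}$, the 1D-weighted number operator $N_u$ is $N_u\xi=\sum_{k=0}^\infty u(k)\partial_k^*\partial_k\xi$, with domain the set of all $\xi$ for which this series converges in $\mathsf{L}^2(Z)$. Here $w(\cdot,n)$ is the function $j\mapsto w(j,n)$ and $w(n,\cdot)$ the function $k\mapsto w(n,k)$; both are bounded and nonnegative. The number operator $N$ is $N\xi=\sum_{\sigma\in\Gamma}\#(\sigma)\langle Z_\sigma,\xi\rangle Z_\sigma$ with $\mathrm{Dom}\,N=\{\xi\in\mathsf{L}^2(Z)\mid\sum_{\sigma\in\Gamma}(\#(\sigma))^2|\langle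 Z_\sigma,\xi\rangle|^2<\infty\}$. An operator identity holding on a subspace means that all terms are defined on every vector of that subspace and the two sides agree there. *)

(* Defs.v *)
From HB Require Import structures.
From mathcomp Require Import all_boot all_order all_algebra finmap.
From mathcomp Require Import generic_quotient ring_quotient complex.
From mathcomp Require Import all_classical all_reals all_analysis.
From mathcomp Require Import measurable_realfun.

Set Implicit Arguments.
Unset Strict Implicit.
Unset Printing Implicit Defensive.

Import Order.TTheory GRing.Theory Num.Theory.
Import numFieldNormedType.Exports.

Local Open Scope classical_set_scope.
Local Open Scope quotient_scope.
Local Open Scope complex_scope.
Local Open Scope ring_scope.

Section ComplexL2.
Context {d : measure_display} {T : measurableType d} {R : realType}.
Variable P : probability T R.
Local Notation Re := (@complex.Re R).
Local Notation Im := (@complex.Im R).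

(* |f|^2 = (Re f)^2 + (Im f)^2, so that f is square integrable iff both parts
   are; [Lfun] includes measurability. *)
Definition sqint : {pred T -> R[i]} :=
  fun f => (Re \o f \in Lfun P 2%:E) && (Im \o f \in Lfun P 2%:E).

Lemma sqint_submod_closed : submod_closed sqint.
Proof.
have [H0 HL] := Lfun_submod_closed P (lee1n 2).
have sc (a : R) f : f \in Lfun P 2%:E -> a *: f \in Lfun P 2%:E.
  by move=> hf; rewrite -[_ *: _]addr0; exact: HL.
have ad f g : f \in Lfun P 2%:E -> g \in Lfun P 2%:E ->
    f + g \in Lfun P 2%:E.
  by move=> hf hg; rewrite -[f]scale1r; exact: HL.
split; first by rewrite unfold_in; apply/andP; split; exact: H0.
move=> a f g /andP[f1 f2] /andP[g1 g2]; rewrite unfold_in; apply/andP; split.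
  rewrite (_ : _ \o _ = Re a *: (Re \o f : T -> R)
    + (- Im a) *: (Im \o f : T -> R) + (Re \o g : T -> R)).
    exact: ad (ad _ _ (sc _ _ f1) (sc _ _ f2)) g1.
  apply/funext => x; rewrite /= !fctE /GRing.scale /=.
  by case: a (f x) (g x) => [a b] [r s] [t u] /=; rewrite mulNr.
rewrite (_ : _ \o _ = Re a *: (Im \o f : T -> R)
  + Im a *: (Re \o f : T -> R) + (Im \o g : T -> R)).
  exact: ad (ad _ _ (sc _ _ f2) (sc _ _ f1)) g2.
apply/funext => x; rewrite /= !fctE /GRing.scale /=.
by case: a (f x) (g x) => [a b] [r s] [t u] /=.
Qed.

HB.instance Definition _ :=
  GRing.isSubmodClosed.Build R[i] (T -> R[i]) sqint sqint_submod_closed.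

Record L2fun := MkL2fun { L2val :> T -> R[i]; _ : L2val \in sqint }.

HB.instance Definition _ := [isSub for L2val].
HB.instance Definition _ := [Choice of L2fun by <:].
HB.instance Definition _ := [SubChoice_isSubLmodule of L2fun by <:].

Definition ae_null : {pred L2fun} := fun f => `[< \forall x \ae P, f x = 0 >].

Lemma ae_null_zmod_closed : zmod_closed ae_null.
Proof.
split; first by apply/asboolP; exact: aeW.
move=> f g /asboolP hf /asboolP hg; apply/asboolP.
by apply: filterS2 hf hg => x fx gx; rewrite /= !fctE /= fx gx subr0.
Qed.

HB.instance Definition _ :=
  GRing.isZmodClosed.Build L2fun ae_null ae_null_zmod_closed.

(* complex L^2(P): square-integrable functions modulo P-a.e. equality *)
Definition L2 : Type := Quotient.quot ae_null.
HB.instance Definition _ := Choice.on L2.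
HB.instance Definition _ := EqQuotient.on L2.
HB.instance Definition _ := GRing.Zmodule.on L2.


Definition L2scale (a : R[i]) : L2 -> L2 := lift_op1 L2 ( *:%R a).

Lemma pi_L2scale a : {morph \pi_L2 : f / a *: f >-> L2scale a f}.
Proof.
move=> f; unlock L2scale; apply/eqP; rewrite piE /= Quotient.equivE -scalerBr.
have /asboolP : f - repr (\pi_L2 f) \in ae_null.
  by rewrite Quotient.idealrBE reprK.
move=> h; apply/asboolP; apply: filterS h => x.
by move=> hx; exact: etrans (congr1 ( *%R a) hx) (mulr0 a).
Qed.
Canonical pi_L2scale_morph a := PiMorph1 (pi_L2scale a).

Lemma L2scaleA a b v : L2scale a (L2scale b v) = L2scale (a * b) v.
Proof. by rewrite -[v]reprK !piE scalerA. Qed.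

Lemma L2scale1 : left_id 1 L2scale.
Proof. by move=> v; rewrite -[v]reprK !piE scale1r. Qed.

Lemma L2scaleDr : right_distributive L2scale +%R.
Proof. by move=> a u v; rewrite -[u]reprK -[v]reprK !piE scalerDr. Qed.

Lemma L2scaleDl v : {morph L2scale^~ v : a b / a + b}.
Proof. by move=> a b; rewrite -[v]reprK !piE scalerDl. Qed.

HB.instance Definition _ := GRing.Zmodule_isLmodule.Build R[i] L2
  L2scaleA L2scale1 L2scaleDr L2scaleDl.

End ComplexL2.

Section Hilbert.
Context {d : measure_display} {T : measurableType d} {R : realType}.
Variable P : probability T R.
Implicit Types (xi eta : L2 P) (s : nat -> L2 P) (A B : L2 P -> L2 P).

(* 0 when f is not square integrable; for the basis vectors [Zbasis] below this
   is excluded by [Zprod_sqint]. *)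
Definition L2class (f : T -> R[i]) : L2 P := \pi_(L2 P) (insubd (0 : L2fun P) f).

Definition cexpectation (f : T -> R[i]) : R[i] :=
  (\int[P]_x complex.Re (f x)) +i* (\int[P]_x complex.Im (f x)).

(* conjugate-linear in the first argument *)
Definition inner xi eta : R[i] :=
  cexpectation (fun x => conjc (repr xi x) * repr eta x).

Definition L2norm xi : R := Num.sqrt (complex.Re (inner xi xi)).

Definition L2cvg s xi := L2norm (s n - xi) @[n --> \oo] --> (0 : R).

Definition L2converges s := exists xi, L2cvg s xi.

(* meaningful only when [L2converges s] *)
Definition L2lim s : L2 P := xget 0 [set xi | L2cvg s xi].

Definition bounded_operator A :=
  linear A /\ exists C : R, forall xi, L2norm (A xi) <= C * L2norm xi.

Definition adjoint_operators A B :=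
  forall xi eta, inner (A xi) eta = inner xi (B eta).

End Hilbert.

Section BernoulliNoise.
Context {d : measure_display} {T : measurableType d} {R : realType}.
Variable P : probability T R.
Implicit Types (p : nat -> R) (Z : nat -> {RV P >-> R}).

Definition independent_sequence Z :=
  forall (J : {fset nat}) (B : nat -> set R), (forall j, measurable (B j)) ->
    P (\bigcap_(j in [set` J]) (Z j @^-1` B j)) =
    (\prod_(j <- J) P (Z j @^-1` B j))%E.

(* sqrt (q_n / p_n), with q_n = 1 - p_n *)
Definition theta p n : R := Num.sqrt ((1 - p n) / p n).

Definition bernoulli_noise p Z :=
  [/\ forall n, 0 < p n < 1,
      independent_sequence Z,
      forall n, P (Z n @^-1` [set theta p n]) = (p n)%:E,
      forall n, P (Z n @^-1` [set - (theta p n)^-1]) = (1 - p n)%:E &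
      @measurable d T =
        <<s \bigcup_n preimage_set_system setT (Z n) (@measurable _ R) >>].

Definition Zprod Z (s : {fset nat}) (x : T) : R := \prod_(i <- s) Z i x.

Lemma bernoulli_noise_bound p Z : bernoulli_noise p Z ->
  forall n, \forall x \ae P, `|Z n x| <= theta p n + (theta p n)^-1.
Proof.
move=> [p01 _ Zp Zq _] n.
have /andP[p0 p1] := p01 n.
have t0 : 0 < theta p n by rewrite sqrtr_gt0 divr_gt0// subr_gt0.
have mZ c : measurable (Z n @^-1` [set c]).
  by rewrite -[X in measurable X]setTI; exact: measurable_funP.
set A := Z n @^-1` [set theta p n]; set B := Z n @^-1` [set - (theta p n)^-1].
have mAB : measurable (A `|` B) by apply: measurableU; exact: mZ.
exists (~` (A `|` B)); split; first exact: measurableC.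
  rewrite probability_setC//.
  have -> : P (A `|` B) = 1%E.
    transitivity (P A + P B)%E.
      apply: measureU; [exact: mZ|exact: mZ|].
      rewrite -subset0 => x []; rewrite /A /B /= => -> /esym tN.
      by have := t0; rewrite -[X in _ < X]tN oppr_gt0 invr_lt0 ltNge ltW.
    by rewrite [P A]Zp [P B]Zq -EFinD addrC subrK.
  by rewrite subee.
apply: subsetC => x [] /= ->.
  by rewrite gtr0_norm// lerDl invr_ge0 ltW.
by rewrite normrN gtr0_norm ?invr_gt0// lerDr ltW.
Qed.

Lemma Zprod_sqint p Z : bernoulli_noise p Z ->
  forall s, (fun x => (Zprod Z s x)%:C) \in sqint P.
Proof.
move=> hZ s; rewrite unfold_in; apply/andP; split; last first.
  exact: (Lfun_submod_closed P (lee1n 2)).1.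
rewrite (_ : _ \o _ = Zprod Z s); last exact/funext.
have mf : measurable_fun setT (Zprod Z s) by exact: measurable_prod.
have [C hC] : exists C, \forall x \ae P, `|Zprod Z s x| <= C.
  rewrite /Zprod; elim: (enum_fset s) => [|i l [C IH]].
    by exists 1; apply: aeW => x; rewrite big_nil normr1.
  exists ((theta p i + (theta p i)^-1) * C).
  apply: filterS2 IH (bernoulli_noise_bound hZ i) => x h1 h2.
  by rewrite big_cons normrM ler_pM.
rewrite inE; apply/andP; split; rewrite inE//=.
rewrite /finite_norm unlock; apply: poweR_lty.
rewrite (@le_lt_trans _ _ (\int[P]_x (cst (C ^+ 2)%:E x))%E)//.
  apply: ae_ge0_le_integral => //=.
  - apply/measurable_EFinP; apply: (measurableT_comp (measurable_powR _)) => //.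
    exact: measurableT_comp.
  - by move=> x _; rewrite lee_fin sqr_ge0.
  - apply: filterS hC => x h _; rewrite powR_mulrn// lee_fin.
    by rewrite lerXn2r// nnegrE (le_trans _ h).
rewrite integral_cst//.
by have := ltry (C ^+ 2); rewrite -[X in (X < _)%E]mule1 -(probability_setT P).
Qed.

Definition Zbasis Z (s : {fset nat}) : L2 P :=
  L2class P (fun x => (Zprod Z s x)%:C).

(* determines A, the [Zbasis Z s] being total in L2 *)
Definition annihilation Z (k : nat) (A : L2 P -> L2 P) :=
  bounded_operator A /\
  forall s, A (Zbasis Z s) = (k \in s)%:R *: Zbasis Z (s `\ k)%fset.

(* domain of the (unweighted) number operator *)
Definition DomN Z : set (L2 P) :=
  [set xi | (\esum_(s in [set: {fset nat}])
    ((#|` s|)%:R ^+ 2 * complex.Re `|inner (Zbasis Z s) xi| ^+ 2)%:E < +oo)%E].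

(* [D k] and [Dadj k] stand for the k-th annihilation operator and its adjoint.
   The weighted number operators are partial: [DomS], [DomNu] are their domains,
   and [Sw], [Nu] carry a meaning only there. *)
Section WeightedNumberOperators.
Variables D Dadj : nat -> L2 P -> L2 P.

(* square partial sums: natural convergence of the double series *)
Definition Sw_sum (w : nat -> nat -> R) (xi : L2 P) (n : nat) : L2 P :=
  \sum_(0 <= j < n.+1) \sum_(0 <= k < n.+1)
    (w j k)%:C *: Dadj k (D j (Dadj j (D k xi))).

Definition DomS w : set (L2 P) := [set xi | L2converges (Sw_sum w xi)].

Definition Sw w (xi : L2 P) : L2 P := L2lim (Sw_sum w xi).

Definition Nu_sum (u : nat -> R) (xi : L2 P) (n : nat) : L2 P :=
  \sum_(0 <= k < n.+1) (u k)%:C *: Dadj k (D k xi).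

Definition DomNu u : set (L2 P) := [set xi | L2converges (Nu_sum u xi)].

Definition Nu u (xi : L2 P) : L2 P := L2lim (Nu_sum u xi).

End WeightedNumberOperators.

End BernoulliNoise.

(* Main.v *)
(* The vectors Z_s form a complete orthonormal system.  Orthonormality follows
   from independence, by integrating products of functions of the two-valued Z_i
   over cylinders.  For totality, an indicator of a set {Z_i in B} is almost
   surely an affine function of Z_i, so a vector orthogonal to every Z_s has zero
   integral over every cylinder, hence over every event by the pi-lambda theorem.

   In this basis all operators are explicit: the n-th partial sum of S_w (resp.
   N_u) multiplies the coefficient at s by a number that increases with n and is
   at most C #(s), where C bounds all partial column sums of w.  On Dom N,
   domination and Riesz-Fischer (L^2 is complete) give convergence, with the
   limits of these numbers as eigenvalues.  As d_n^* moves the coefficient at t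
   to t U {n} for n not in t, the identity reduces to one between the
   eigenvalues at t U {n} and at t, which holds for the partial sums themselves
   from rank n on. *)
Require Import Defs.
From HB Require Import structures.
From mathcomp Require Import all_boot all_order all_algebra finmap.
From mathcomp Require Import complex.
From mathcomp Require Import all_classical all_reals all_analysis.
From mathcomp Require Import generic_quotient ring_quotient measurable_realfun.
From mathcomp Require Import ring lra.
Import Order.TTheory GRing.Theory Num.Theory.
Import numFieldNormedType.Exports.
Local Open Scope classical_set_scope.
Local Open Scope quotient_scope.
Local Open Scope complex_scope.
Local Open Scope ring_scope.

Set Implicit Arguments.
Unset Strict Implicit.
Unset Printing Implicit Defensive.

(** * L2 as a complex inner product space *)

Section ComplexExpectation.
Context {d : measure_display} {T : measurableType d} {R : realType}.
Variable P : probability T R.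
Local Notation Re := (@complex.Re R).
Local Notation Im := (@complex.Im R).
Implicit Types f g : T -> R[i].

Definition cintegrable f :=
  P.-integrable setT (fun x => (Re (f x))%:E) /\
  P.-integrable setT (fun x => (Im (f x))%:E).

Lemma creD (a b : R[i]) : Re (a + b) = Re a + Re b.
Proof. by case: a b => [? ?] []. Qed.
Lemma cimD (a b : R[i]) : Im (a + b) = Im a + Im b.
Proof. by case: a b => [? ?] []. Qed.
Lemma creM (a b : R[i]) : Re (a * b) = Re a * Re b - Im a * Im b.
Proof. by case: a b => [? ?] []. Qed.
Lemma cimM (a b : R[i]) : Im (a * b) = Re a * Im b + Im a * Re b.
Proof. by case: a b => [? ?] []. Qed.
Lemma creJ (a : R[i]) : Re (conjc a) = Re a. Proof. by case: a. Qed.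
Lemma cimJ (a : R[i]) : Im (conjc a) = - Im a. Proof. by case: a. Qed.

Lemma cjD (a b : R[i]) : conjc (a + b) = conjc a + conjc b.
Proof. exact: rmorphD. Qed.
Lemma cjM (a b : R[i]) : conjc (a * b) = conjc a * conjc b.
Proof. exact: rmorphM. Qed.
Lemma cjN (a : R[i]) : conjc (- a) = - conjc a.
Proof. exact: rmorphN. Qed.

Lemma complex_ext (a b : R[i]) : Re a = Re b -> Im a = Im b -> a = b.
Proof. by case: a b => [? ?] [? ?] /= -> ->. Qed.

Lemma ae_eq_Rintegral (f g : T -> R) :
  measurable_fun setT f -> measurable_fun setT g ->
  (\forall x \ae P, f x = g x) -> \int[P]_x f x = \int[P]_x g x.
Proof.
move=> mf mg fg; congr fine; apply: ae_eq_integral => //.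
- exact/measurable_EFinP.
- exact/measurable_EFinP.
- by apply: filterS fg => x -> _.
Qed.

Lemma cintegrable_meas f : cintegrable f ->
  measurable_fun setT (Re \o f) /\ measurable_fun setT (Im \o f).
Proof.
by move=> [/measurable_int/measurable_EFinP ? /measurable_int/measurable_EFinP].
Qed.

Lemma cexpectation_ae_eq f g : cintegrable f -> cintegrable g ->
  (\forall x \ae P, f x = g x) -> cexpectation P f = cexpectation P g.
Proof.
move=> /cintegrable_meas[f1 f2] /cintegrable_meas[g1 g2] fg.
by congr Complex; apply: ae_eq_Rintegral => //; apply: filterS fg => x /= ->.
Qed.

Lemma cexpectationD f g : cintegrable f -> cintegrable g ->
  cexpectation P (fun x => f x + g x) = cexpectation P f + cexpectation P g.
Proof.
move=> [f1 f2] [g1 g2]; apply: complex_ext => /=.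
  by rewrite -RintegralD//; apply: eq_Rintegral => x _; rewrite creD.
by rewrite -RintegralD//; apply: eq_Rintegral => x _; rewrite cimD.
Qed.

Lemma integrable_scale (a : R) (f : T -> R) : P.-integrable setT (EFin \o f) ->
  P.-integrable setT (fun x => (a * f x)%:E).
Proof.
move=> h; under [X in integrable _ _ X]funext => x do rewrite EFinM.
exact: integrableZl.
Qed.

Lemma cexpectationZ a f : cintegrable f ->
  cexpectation P (fun x => a * f x) = a * cexpectation P f.
Proof.
move=> [f1 f2]; apply: complex_ext; rewrite /= ?creM ?cimM /=.
  rewrite -!RintegralZl// -RintegralB//; do ?exact: integrable_scale.
  by apply: eq_Rintegral => x _; rewrite creM.
rewrite -!RintegralZl// -RintegralD//; do ?exact: integrable_scale.
by apply: eq_Rintegral => x _; rewrite cimM.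
Qed.

Lemma cexpectationJ f : cintegrable f ->
  cexpectation P (fun x => conjc (f x)) = conjc (cexpectation P f).
Proof.
move=> [f1 f2]; apply: complex_ext; rewrite /= ?creJ ?cimJ /=.
  by apply: eq_Rintegral => x _; rewrite creJ.
rewrite -mulN1r -RintegralZl//.
by apply: eq_Rintegral => x _; rewrite cimJ mulN1r.
Qed.

Lemma Lfun2_mul_integrable (f g : T -> R) :
  f \in Lfun P 2%:E -> g \in Lfun P 2%:E ->
  P.-integrable setT (fun x => (f x * g x)%:E).
Proof. by move=> hf hg; apply/Lfun1_integrable; exact: Lfun2_mul_Lfun1. Qed.

Lemma sqint_mul f g : f \in sqint P -> g \in sqint P ->
  cintegrable (fun x => conjc (f x) * g x).
Proof.
move=> /andP[f1 f2] /andP[g1 g2]; split.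
  under [X in integrable _ _ X]funext => x do
    rewrite creM creJ cimJ mulNr opprK EFinD.
  by apply: integrableD => //;
    exact: (Lfun2_mul_integrable (f := _ \o f) (g := _ \o g)).
under [X in integrable _ _ X]funext => x do
  rewrite cimM creJ cimJ mulNr EFinB.
by apply: integrableB => //;
  exact: (Lfun2_mul_integrable (f := _ \o f) (g := _ \o g)).
Qed.

Lemma L2valP (f : L2fun P) : (f : T -> R[i]) \in sqint P.
Proof. exact: valP. Qed.

Lemma pi_L2_eq (f g : L2fun P) :
  \pi_(L2 P) f = \pi_(L2 P) g -> \forall x \ae P, f x = g x.
Proof.
move/eqP; rewrite piE Quotient.equivE => /asboolP.
by apply: filterS => x /subr0_eq.
Qed.

(** [inner] is computed from the chosen representatives [repr]; these agree almost everywhere with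
    [f] and [g], so the integral does not see the choice. *)
Lemma inner_pi (f g : L2fun P) :
  inner (\pi_(L2 P) f) (\pi_(L2 P) g) =
  cexpectation P (fun x => conjc (f x) * g x).
Proof.
apply: cexpectation_ae_eq; do ?by apply: sqint_mul; exact: L2valP.
have := @pi_L2_eq (repr (\pi_(L2 P) f)) f (reprK _).
have := @pi_L2_eq (repr (\pi_(L2 P) g)) g (reprK _).
by apply: filterS2 => x -> ->.
Qed.

End ComplexExpectation.

(** * Sesquilinearity and the squared norm *)

Section InnerProduct.
Context {d : measure_display} {T : measurableType d} {R : realType}.
Variable P : probability T R.
Implicit Types x y z : L2 P.

Lemma L2_ind (K : L2 P -> Prop) : (forall f : L2fun P, K (\pi f)) ->
  forall x, K x.
Proof. by move=> h x; rewrite -[x]reprK. Qed.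

Lemma pi_L2D (f g : L2fun P) : \pi_(L2 P) f + \pi_(L2 P) g = \pi_(L2 P) (f + g).
Proof. by rewrite !piE. Qed.

Lemma pi_L2Z a (f : L2fun P) : a *: \pi_(L2 P) f = \pi_(L2 P) (a *: f).
Proof. rewrite [RHS](@pi_L2scale _ _ _ P a f). reflexivity. Qed.

Lemma innerDr x y z : inner x (y + z) = inner x y + inner x z.
Proof.
elim/L2_ind: x => f; elim/L2_ind: y => g; elim/L2_ind: z => h.
rewrite pi_L2D !inner_pi -cexpectationD; do ?by apply: sqint_mul; exact: L2valP.
by congr (cexpectation P _); apply/funext => t; rewrite -mulrDr.
Qed.

Lemma innerZr a x y : inner x (a *: y) = a * inner x y.
Proof.
elim/L2_ind: x => f; elim/L2_ind: y => g.
rewrite pi_L2Z !inner_pi -cexpectationZ; last by apply: sqint_mul;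
  exact: L2valP.
by congr (cexpectation P _); apply/funext => t; rewrite mulrCA.
Qed.

Lemma innerJ x y : inner x y = conjc (inner y x).
Proof.
elim/L2_ind: x => f; elim/L2_ind: y => g.
rewrite !inner_pi -cexpectationJ; last by apply: sqint_mul; exact: L2valP.
congr (cexpectation P _); apply/funext => t.
by rewrite cjM conjcK mulrC.
Qed.

Lemma inner0r x : inner x 0 = 0.
Proof. by rewrite -[0 in LHS](scale0r (0 : L2 P)) innerZr mul0r. Qed.

Lemma innerNr x y : inner x (- y) = - inner x y.
Proof. by rewrite -scaleN1r innerZr mulN1r. Qed.

Lemma innerBr x y z : inner x (y - z) = inner x y - inner x z.
Proof. by rewrite innerDr innerNr. Qed.

Lemma inner_sumr I (r : seq I) (Q : pred I) x (F : I -> L2 P) :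
  inner x (\sum_(i <- r | Q i) F i) = \sum_(i <- r | Q i) inner x (F i).
Proof.
exact: (big_morph (inner x) (innerDr x) (inner0r x)).
Qed.

Lemma innerDl x y z : inner (x + y) z = inner x z + inner y z.
Proof. by rewrite innerJ innerDr cjD -!innerJ. Qed.

Lemma innerZl a x y : inner (a *: x) y = conjc a * inner x y.
Proof. by rewrite innerJ innerZr cjM -innerJ. Qed.

Lemma innerNl x y : inner (- x) y = - inner x y.
Proof. by rewrite innerJ innerNr cjN -innerJ. Qed.

Lemma innerBl x y z : inner (x - y) z = inner x z - inner y z.
Proof. by rewrite innerDl innerNl. Qed.

(** The square of [L2norm]; estimates are made with it to keep them free of square roots. *)
Definition sqnorm x : R := complex.Re (inner x x).

Lemma sqnorm_pi (f : L2fun P) :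
  sqnorm (\pi f) = \int[P]_t (complex.Re (f t) ^+ 2 + complex.Im (f t) ^+ 2).
Proof.
rewrite /sqnorm inner_pi /=; apply: eq_Rintegral => t _.
by rewrite creM creJ cimJ mulNr opprK !expr2.
Qed.

Lemma sqnorm_ge0 x : 0 <= sqnorm x.
Proof.
elim/L2_ind: x => f; rewrite sqnorm_pi; apply: Rintegral_ge0 => t _.
by rewrite addr_ge0 ?sqr_ge0.
Qed.

(** By conjugate symmetry [inner x x] is its own conjugate, so its imaginary part vanishes. *)
Lemma inner_sqnorm x : inner x x = (sqnorm x)%:C.
Proof.
apply: complex_ext => //; have := congr1 (@complex.Im R) (innerJ x x).
rewrite cimJ -[complex.Im _%:C]/0 => h; lra.
Qed.

Lemma sqnormN x : sqnorm (- x) = sqnorm x.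
Proof. by rewrite /sqnorm innerNl innerNr opprK. Qed.

(** Rearranges [0 <= sqnorm (x - y)]. It stands in for the triangle inequality; the factor 2 in
    [Riesz_Fischer] comes from it. *)
Lemma sqnorm_parallelogram x y : sqnorm (x + y) <= 2 * sqnorm x + 2 * sqnorm y.
Proof.
have := sqnorm_ge0 (x - y); rewrite /sqnorm.
rewrite innerBl !innerBr innerDl !innerDr !opprB !creD !raddfN /=.
lra.
Qed.

Lemma sqnormD_orth x y : inner x y = 0 -> sqnorm (x + y) = sqnorm x + sqnorm y.
Proof.
move=> h; rewrite /sqnorm innerDl !innerDr h (innerJ y x) h conjc0 addr0 add0r.
by rewrite creD.
Qed.

End InnerProduct.

(** * Completeness of L2 *)

Section RealL2Complete.
Context {d : measure_display} {T : measurableType d} {R : realType}.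
Variable P : probability T R.

Lemma Lfun2_of_sqr_integral (f : T -> R) : measurable_fun setT f ->
  (\int[P]_x (f x ^+ 2)%:E < +oo)%E -> f \in Lfun P 2%:E.
Proof.
move=> mf foo; rewrite inE; apply/andP; split; rewrite inE//=.
rewrite /finite_norm unlock; apply: poweR_lty.
apply: le_lt_trans foo; rewrite le_eqVlt; apply/orP; left; apply/eqP.
by apply: eq_integral => x _; rewrite /= powR_mulrn// real_normK// num_real.
Qed.

Lemma Lfun2_measurable (f : T -> R) : f \in Lfun P 2%:E ->
  measurable_fun setT f.
Proof. by move=> /sub_Lfun_mfun; rewrite inE. Qed.

Lemma Lfun2B (f g : T -> R) : f \in Lfun P 2%:E -> g \in Lfun P 2%:E ->
  (fun x => f x - g x) \in Lfun P 2%:E.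
Proof.
move=> hf hg; have := (Lfun_submod_closed P (lee1n 2)).2 (-1) g f hg hf.
rewrite [X in X \in _ -> _](_ : _ = (fun x => f x - g x))//.
by apply/funext => x; rewrite !fctE scaleN1r addrC.
Qed.

Lemma limn_einf_le (u : nat -> \bar R) (c : \bar R) k :
  (forall m, (k <= m)%N -> (u m <= c)%E) -> (limn_einf u <= c)%E.
Proof.
move=> h; rewrite limn_einf_lim.
apply/lime_le; first exact: is_cvg_einfs.
apply: nearW => n; apply: (@le_trans _ _ (u (maxn n k))).
  by apply: ereal_inf_lbound; exists (maxn n k) => //=; exact: leq_maxl.
by apply: h; exact: leq_maxr.
Qed.

Section fast.
Variable f : nat -> T -> R.
Hypothesis f2 : forall n, f n \in Lfun P 2%:E.
Hypothesis f_fast : forall k m, (k <= m)%N ->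
  (\int[P]_x ((f m x - f k x) ^+ 2)%:E <= ((4 ^+ k)^-1)%:E)%E.

Let h n x : R := `|f n.+1 x - f n x|.
Let S x : \bar R := (\sum_(0 <= n <oo) (h n x)%:E)%E.

Let mf n : measurable_fun setT (f n). Proof. exact: Lfun2_measurable. Qed.

Let mh n : measurable_fun setT (h n).
Proof. by apply: measurableT_comp => //; apply: measurable_funB. Qed.

(* AM-GM: |h| <= 2^n h^2 + 2^-n *)
Let int_h n : (\int[P]_x (h n x)%:E <= (4 / (2 ^ n.+1)%:R)%:E)%E.
Proof.
have t0 : 0 < (2 : R) ^+ n by rewrite exprn_gt0.
apply: (@le_trans _ _ (\int[P]_x ((2 ^+ n)%:E * (h n x ^+ 2)%:E
    + (cst ((2 ^+ n)^-1) x)%:E))%E).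
  apply: ge0_le_integral => //.
  - by move=> x _; rewrite lee_fin /h.
  - exact/measurable_EFinP.
  - apply: emeasurable_funD; last exact/measurable_EFinP.
    apply: emeasurable_funM => //.
    by apply/measurable_EFinP; exact: measurable_funX.
  - move=> x _; rewrite -EFinM -EFinD lee_fin /=.
    set y := h n x; set t := 2 ^+ n in t0 *.
    have : 0 <= t * (y - (2 * t)^-1) ^+ 2 by rewrite mulr_ge0 ?sqr_ge0// ltW.
    have -> : t * (y - (2 * t)^-1) ^+ 2 = t * y ^+ 2 - y + t^-1 / 4.
      by field; rewrite gt_eqF.
    have : 0 < t^-1 by rewrite invr_gt0.
    lra.
rewrite ge0_integralD//; last 4 first.
- by move=> x _; rewrite -EFinM lee_fin mulr_ge0 ?sqr_ge0// ltW.
- apply: emeasurable_funM => //.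
  by apply/measurable_EFinP; exact: measurable_funX.
- by move=> x _; rewrite lee_fin invr_ge0 ltW.
- exact/measurable_EFinP.
rewrite ge0_integralZl_EFin//; last 2 first.
- by move=> x _; rewrite lee_fin sqr_ge0.
- by apply/measurable_EFinP; exact: measurable_funX.
have -> : (\int[P]_x (cst ((2 ^+ n)^-1) x)%:E = ((2 ^+ n)^-1)%:E)%E.
  have := integral_cst P (@measurableT _ T) ((2 ^+ n)^-1)%:E.
  by rewrite [X in (_ * X)%E](probability_setT P) mule1.
(* The two terms contribute 2^n 4^-n and 2^-n, in total 2 * 2^-n; written as 4 / 2^(n+1), it has the
   form summed by [epsilon_trick0]. *)
have -> : (4 / (2 ^ n.+1)%:R)%:E
    = ((2 ^+ n)%:E * ((4 ^+ n)^-1)%:E + ((2 ^+ n)^-1)%:E)%E :> \bar R.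
  rewrite -EFinM -EFinD; congr EFin.
  have -> : 4 ^+ n = 2 ^+ n * 2 ^+ n :> R.
    by rewrite -exprMn; congr (_ ^+ n); rewrite -natrM.
  by rewrite natrX exprS; field; rewrite gt_eqF.
apply: leeD => //; apply: lee_wpmul2l; first by rewrite lee_fin ltW.
apply: le_trans (f_fast (leqnSn n)).
rewrite le_eqVlt; apply/orP; left; apply/eqP; apply: eq_integral => x _.
by rewrite /h real_normK// num_real.
Qed.

Let mS : measurable_fun setT S.
Proof.
apply: (ge0_emeasurable_sum (P := xpredT)) => [k x _ _|k _].
  by rewrite lee_fin /h.
exact/measurable_EFinP.
Qed.

Let S0 x : (0 <= S x)%E.
Proof. by apply: nneseries_ge0 => n _ _; rewrite lee_fin /h. Qed.

Let int_S : (\int[P]_x S x < +oo)%E.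
Proof.
rewrite integral_nneseries//; last 2 first.
- by move=> n; exact/measurable_EFinP.
- by move=> n x _; rewrite lee_fin /h.
apply: (@le_lt_trans _ _ (\sum_(n <oo) (4 / (2 ^ n.+1)%:R)%:E)%E).
  apply: lee_nneseries => [n _ _|n _]; last exact: int_h.
  by apply: integral_ge0 => x _; rewrite lee_fin /h.
by apply: le_lt_trans (epsilon_trick0 xpredT _) _; rewrite ?ltry.
Qed.

Let A := [set x | (S x < +oo)%E].

Let mA : measurable A.
Proof.
rewrite -[A]setTI; exact: (measurable_lte measurableT mS (measurable_cst _)).
Qed.

Let aeA : \forall x \ae P, A x.
Proof.
have : P.-integrable setT S.
  apply/integrableP; split => //.
  by under eq_integral => x _ do rewrite gee0_abs//.
move/(integrable_ae measurableT); apply: filterS => x /(_ I).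
by rewrite /A /= ge0_fin_numE.
Qed.

(** Cutting off outside [A] changes [f n] only on a null set and makes the sequence converge at
    every point, so that its limit is measurable. *)
Let f' n x := f n x * \1_A x.

Let mf' n : measurable_fun setT (f' n).
Proof. by apply: measurable_funM. Qed.

Let cvg_f' x : cvgn (f'^~ x).
Proof.
rewrite /f' indicE; have [xA|xA] := boolP (x \in A); last first.
  rewrite (_ : (fun _ => _) = cst 0); last by apply/funext => n; rewrite mulr0.
  exact: is_cvg_cst.
under [X in cvgn X]funext do rewrite mulr1.
have hc : cvgn [normed series (telescope (f^~ x))].
  apply: nnseries_is_cvg => [i|]; first exact: normr_ge0.
  by move: xA; rewrite inE.
rewrite (_ : f^~ x = (fun n => f 0 x + series (telescope (f^~ x)) n)).
  by apply: is_cvgD; [exact: is_cvg_cst|exact: normed_cvg].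
by apply/funext => n; exact: (eq_sum_telescope (f^~ x)).
Qed.

(** The increments are absolutely summable on the full-measure set [A], which yields a pointwise
    limit; Fatou's lemma in the index m then carries the bound on [f m - f k] over to the limit. *)
Lemma L2_fast_cauchy_limit : exists2 g : T -> R, g \in Lfun P 2%:E &
  forall k, (\int[P]_x ((f k x - g x) ^+ 2)%:E <= ((4 ^+ k)^-1)%:E)%E.
Proof.
pose g x := limn (f'^~ x).
have mg : measurable_fun setT g.
  by apply: (measurable_fun_cvg (h := f')) => // x _; exact: cvg_f'.
have mf'f n m : measurable_fun setT (fun x => (f' m x - f' n x) ^+ 2).
  by apply: measurable_funX; exact: measurable_funB.
have hg k : (\int[P]_x ((f k x - g x) ^+ 2)%:E <= ((4 ^+ k)^-1)%:E)%E.
  have -> : (\int[P]_x ((f k x - g x) ^+ 2)%:E =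
      \int[P]_x (limn_einf (fun m => ((f' m x - f' k x) ^+ 2)%:E)))%E.
    have -> : (\int[P]_x ((f k x - g x) ^+ 2)%:E =
        \int[P]_x ((g x - f' k x) ^+ 2)%:E)%E.
      apply: ae_eq_integral => //.
      + by apply/measurable_EFinP; apply: measurable_funX;
        exact: measurable_funB.
      + by apply/measurable_EFinP; apply: measurable_funX;
        exact: measurable_funB.
      + apply: filterS aeA => x Ax _; rewrite /f' indicE mem_set// mulr1.
        by rewrite -sqrrN opprB.
    apply: eq_integral => x _; apply/esym.
    apply: (cvg_limn_einf_sup _).1.
    apply/cvg_EFin; first exact: nearW.
    apply: (@cvg_comp _ _ _ (fun m => f' m x - f' k x) (fun y =>
      y ^+ 2) _ (nbhs (g x - f' k x))).
      by apply: cvgB; [exact: cvg_f'|exact: cvg_cst].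
    exact: exprn_continuous.
  apply: le_trans (fatou _ _ _ _) _ => //.
  - by move=> n; exact/measurable_EFinP.
  - by move=> n x _; rewrite lee_fin sqr_ge0.
  apply: (limn_einf_le (k := k)) => m km.
  apply: le_trans (f_fast km).
  rewrite le_eqVlt; apply/orP; left; apply/eqP; apply: ae_eq_integral => //.
  + exact/measurable_EFinP.
  + by apply/measurable_EFinP; apply: measurable_funX; exact: measurable_funB.
  + by apply: filterS aeA => x Ax _; rewrite /f' indicE mem_set// !mulr1.
exists g => //.
(* The bound at k = 0 makes [f 0 - g] square integrable, hence also [g], as [f 0] minus this
   difference. *)
have h0 : (fun x => f 0 x - g x) \in Lfun P 2%:E.
  apply: Lfun2_of_sqr_integral; first exact: measurable_funB.
  by apply: le_lt_trans (hg 0) _; rewrite ltry.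
have := Lfun2B (f2 0) h0.
rewrite [X in X \in _ -> _](_ : _ = g)//.
by apply/funext => x; rewrite opprB addrC subrK.
Qed.

End fast.
End RealL2Complete.

(** * From real to complex L^2 *)

Section L2Complete.
Context {d : measure_display} {T : measurableType d} {R : realType}.
Variable P : probability T R.

Lemma L2valB (f g : L2fun P) x : (f - g) x = f x - g x :> R[i].
Proof. by []. Qed.

Lemma sqnorm_pi_parts (f : L2fun P) :
  ((sqnorm (\pi_(L2 P) f))%:E =
   \int[P]_t (complex.Re (f t) ^+ 2)%:E + \int[P]_t (complex.Im (f t) ^+
     2)%:E)%E.
Proof.
have /andP[/Lfun2_integrable_sqr h1 /Lfun2_integrable_sqr h2] := L2valP f.
rewrite sqnorm_pi RintegralD// EFinD.
by rewrite !fineK//; exact: integrable_fin_num.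
Qed.

(** The real and imaginary parts are fast Cauchy sequences themselves; each limit contributes one
    error 4^-k, whence the factor 2. *)
Lemma L2_fast_cauchy (s : nat -> L2 P) :
  (forall k m, (k <= m)%N -> sqnorm (s m - s k) <= (4 ^+ k)^-1) ->
  exists y, forall k, sqnorm (s k - y) <= 2 * (4 ^+ k)^-1.
Proof.
move=> s_fast; pose f n : L2fun P := repr (s n).
have sE n : s n = \pi_(L2 P) (f n) by rewrite /f reprK.
have sBE m (g : L2fun P) : s m - \pi_(L2 P) g = \pi_(L2 P) (f m - g).
  by rewrite sE !piE.
(* Here [h] is the real or the imaginary part: additive, measurable along [L2fun], and with square
   at most the squared modulus. *)
have fast (h : R[i] -> R) : (forall a b, h (a - b) = h a - h b) ->
    (forall z, h z ^+ 2 <= complex.Re z ^+ 2 + complex.Im z ^+ 2) ->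
    (forall g : L2fun P, measurable_fun setT (h \o g)) ->
    forall k m, (k <= m)%N ->
    (\int[P]_x ((h (f m x) - h (f k x)) ^+ 2)%:E <= ((4 ^+ k)^-1)%:E)%E.
  move=> hB hle mh k m /s_fast; rewrite (sE k) sBE -lee_fin; apply: le_trans.
  have [/andP[m1 m2] mB] := (L2valP (f m - f k), mh (f m - f k)).
  rewrite sqnorm_pi_parts -ge0_integralD//.
  - apply: ge0_le_integral => //.
    + by move=> x _; rewrite lee_fin sqr_ge0.
    + under [X in measurable_fun _ X]funext => x do rewrite -hB.
      by apply/measurable_EFinP; apply: measurable_funX mB.
    + apply: emeasurable_funD; apply/measurable_EFinP; apply: measurable_funX.
        exact: Lfun2_measurable m1.
      exact: Lfun2_measurable m2.
    + by move=> x _; rewrite -hB -EFinD lee_fin; exact: hle.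
  - by move=> x _; rewrite lee_fin sqr_ge0.
  - by apply/measurable_EFinP; apply: measurable_funX (Lfun2_measurable m1).
  - by move=> x _; rewrite lee_fin sqr_ge0.
  - by apply/measurable_EFinP; apply: measurable_funX (Lfun2_measurable m2).
have re2 n : (fun x => complex.Re (f n x)) \in Lfun P 2%:E.
  by have /andP[] := L2valP (f n).
have im2 n : (fun x => complex.Im (f n x)) \in Lfun P 2%:E.
  by have /andP[] := L2valP (f n).
have [u u2 hu] : exists2 u : T -> R, u \in Lfun P 2%:E & forall k,
    (\int[P]_x ((complex.Re (f k x) - u x) ^+ 2)%:E <= ((4 ^+ k)^-1)%:E)%E.
  apply: (L2_fast_cauchy_limit re2); apply: (fast (@complex.Re R)).
  - by move=> [? ?] [? ?].
  - by move=> z; rewrite lerDl sqr_ge0.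
  - by move=> g; have /andP[/Lfun2_measurable] := L2valP g.
have [v v2 hv] : exists2 v : T -> R, v \in Lfun P 2%:E & forall k,
    (\int[P]_x ((complex.Im (f k x) - v x) ^+ 2)%:E <= ((4 ^+ k)^-1)%:E)%E.
  apply: (L2_fast_cauchy_limit im2); apply: (fast (@complex.Im R)).
  - by move=> [? ?] [? ?].
  - by move=> z; rewrite lerDr sqr_ge0.
  - by move=> g; have /andP[_ /Lfun2_measurable] := L2valP g.
have uv : (fun x => u x +i* v x) \in sqint P by apply/andP; split.
exists (\pi_(L2 P) (MkL2fun uv)) => k; rewrite sBE -lee_fin sqnorm_pi_parts.
rewrite mulr2n mulrDl mul1r EFinD; apply: leeD.
  apply: le_trans (hu k); rewrite le_eqVlt; apply/orP; left; apply/eqP.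
  by apply: eq_integral => x _; rewrite L2valB; case: (f k x).
apply: le_trans (hv k); rewrite le_eqVlt; apply/orP; left; apply/eqP.
by apply: eq_integral => x _; rewrite L2valB; case: (f k x).
Qed.

End L2Complete.

(** * The noise basis: orthonormality and totality *)

Section AeBounded.
Context {d : measure_display} {T : measurableType d} {R : realType}.
Variable P : probability T R.
Implicit Types u v g : T -> R.

(** The bound is almost sure because [Z n] takes its two values only off a null set. *)
Definition ae_bounded u :=
  measurable_fun setT u /\ exists C : R, \forall x \ae P, `|u x| <= C.

Lemma ae_bounded_cst c : ae_bounded (fun=> c).
Proof. by split => //; exists `|c|; exact: aeW. Qed.

Lemma ae_boundedM u v : ae_bounded u -> ae_bounded v ->
  ae_bounded (fun x => u x * v x).
Proof.
move=> [mu [C hC]] [mv [D hD]]; split; first exact: measurable_funM.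
by exists (C * D); apply: filterS2 hC hD => x h1 h2; rewrite normrM ler_pM.
Qed.

Lemma ae_boundedD u v : ae_bounded u -> ae_bounded v ->
  ae_bounded (fun x => u x + v x).
Proof.
move=> [mu [C hC]] [mv [D hD]]; split; first exact: measurable_funD.
exists (C + D); apply: filterS2 hC hD => x h1 h2.
by rewrite (le_trans (ler_normD _ _))// lerD.
Qed.

Lemma ae_bounded_indic A : measurable A -> ae_bounded (\1_A).
Proof.
move=> mA; split => //; exists 1; apply: aeW => x.
by rewrite indicE normr_nat lern1 leq_b1.
Qed.

Lemma ae_bounded_prod (I : eqType) (l : seq I) (u : I -> T -> R) :
  (forall i, ae_bounded (u i)) -> ae_bounded (fun x => \prod_(i <- l) u i x).
Proof.
move=> hu; elim: l => [|i l IH].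
  under [X in ae_bounded X]funext => x do rewrite big_nil.
  exact: ae_bounded_cst.
under [X in ae_bounded X]funext => x do rewrite big_cons.
exact: ae_boundedM.
Qed.

Lemma ae_bounded_integrable u g : ae_bounded u ->
  P.-integrable setT (EFin \o g) ->
  P.-integrable setT (fun x => (u x * g x)%:E).
Proof.
move=> [mu [C hC]] ig; have mg := measurable_int _ ig.
have mg' : measurable_fun setT g by exact/measurable_EFinP.
apply/integrableP; split; first by apply/measurable_EFinP;
  exact: measurable_funM.
have igC := integrableZl measurableT C ig.
case/integrableP: igC => _; apply: le_lt_trans.
apply: ae_ge0_le_integral => //.
- by apply/measurable_EFinP; apply: measurableT_comp => //;
  exact: measurable_funM.
- by apply: measurableT_comp => //; exact: emeasurable_funM.
- apply: filterS hC => x hx _; rewrite -EFinM lee_fin !normrM.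
  by apply: ler_pM => //; apply: le_trans hx _; exact: ler_norm.
Qed.

Lemma ae_bounded_integrable1 u : ae_bounded u ->
  P.-integrable setT (fun x => (u x)%:E).
Proof.
move=> hu; have i1 : P.-integrable setT (EFin \o cst (1 : R)).
  exact: finite_measure_integrable_cst.
have := ae_bounded_integrable hu i1.
by under [X in integrable _ _ X]funext => x do rewrite mulr1.
Qed.

End AeBounded.

(** * The two-valued noise and its moments over cylinders *)

Section Noise.
Context {d : measure_display} {T : measurableType d} {R : realType}.
Variable P : probability T R.
Variables (p : nat -> R) (Z : nat -> {RV P >-> R}).
Hypothesis hZ : bernoulli_noise p Z.

Let p01 n : 0 < p n < 1. Proof. by have [] := hZ. Qed.
Let tn n : R := - (theta p n)^-1.

Lemma theta_gt0 n : 0 < theta p n.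
Proof.
have /andP[p0 p1] := p01 n.
by rewrite /theta sqrtr_gt0 divr_gt0// subr_gt0.
Qed.

Lemma theta_sqr n : p n * theta p n ^+ 2 = 1 - p n.
Proof.
have /andP[p0 p1] := p01 n.
rewrite /theta sqr_sqrtr; last by rewrite divr_ge0 ?subr_ge0 // ltW.
by rewrite mulrC divfK// gt_eqF.
Qed.

Lemma theta_neq n : theta p n != tn n.
Proof.
rewrite /tn -subr_eq0 opprK gt_eqF// addr_gt0 ?theta_gt0//.
by rewrite invr_gt0 theta_gt0.
Qed.

Lemma measurable_preimage_Z n B : measurable B -> measurable (Z n @^-1` B).
Proof.
by move=> mB; rewrite -[X in measurable X]setTI; exact: measurable_funP.
Qed.

(** The two values differ, so their events are disjoint, and the probabilities p and 1 - p add up to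
    1. *)
Lemma noise_two_valued n :
  \forall x \ae P, (Z n x = theta p n) \/ (Z n x = tn n).
Proof.
have [_ _ Zp Zq _] := hZ.
set A := Z n @^-1` [set theta p n]; set B := Z n @^-1` [set tn n].
have mA : measurable A by exact: measurable_preimage_Z.
have mB : measurable B by exact: measurable_preimage_Z.
have mAB : measurable (A `|` B) by exact: measurableU.
exists (~` (A `|` B)); split; [exact: measurableC| |by move=> x;
  apply: contra_not].
have PAB : P (A `|` B) = 1%E.
  transitivity (P A + P B)%E.
    apply: measureU => //; rewrite -subset0 => x [] /=; rewrite /A /B /= => ->.
    by move/eqP; rewrite (negPf (theta_neq n)).
  by rewrite [P A]Zp [P B]Zq -EFinD addrC subrK.
have := probability_setC P mAB; rewrite PAB => ->.
by rewrite subee.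
Qed.

Lemma ae_bounded_noise n (phi : R -> R) : measurable_fun setT phi ->
  ae_bounded P (fun x => phi (Z n x)).
Proof.
move=> mphi; split; first exact: measurableT_comp.
exists (`|phi (theta p n)| + `|phi (tn n)|).
apply: filterS (noise_two_valued n) => x [] ->; first by rewrite lerDl.
by rewrite lerDr.
Qed.

Definition cylinder (J : {fset nat}) (B : nat -> set R) : set T :=
  \bigcap_(j in [set` J]) (Z j @^-1` B j).

Lemma measurable_cylinder J B : (forall j, measurable (B j)) ->
  measurable (cylinder J B).
Proof.
by move=> mB; apply: bigcap_measurableType => k _; exact: measurable_preimage_Z.
Qed.

Lemma cylinder_split i J B (C : set R) : i \notin J ->
  cylinder (i |` J)%fset (fun j => if j == i then C else B j) =
  cylinder J B `&` Z i @^-1` C.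
Proof.
move=> iJ; apply/seteqP; split => [x h|x [h1 h2] j /=].
  split => [j /= jJ|].
    have := h j; rewrite /= in_fset1U jJ orbT => /(_ isT).
    by case: eqP => // ji; rewrite ji (negPf iJ) in jJ.
  by have := h i; rewrite /= in_fset1U eqxx => /(_ isT).
rewrite in_fset1U; case: eqP => [->|_] //= jJ.
exact: h1.
Qed.

Lemma probability_cylinder_split i J B (c : R) : i \notin J ->
  (forall j, measurable (B j)) ->
  P (cylinder J B `&` Z i @^-1` [set c]) =
  (P (Z i @^-1` [set c]) * P (cylinder J B))%E.
Proof.
move=> iJ mB; have [_ ind _ _ _] := hZ.
rewrite -cylinder_split// /cylinder !ind//; last first.
  by move=> j; case: eqP => // _.
rewrite big_fsetU1//= eqxx; congr (_ * _)%E.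
apply: eq_big_seq => j jJ; case: eqP => // ji.
by rewrite ji (negPf iJ) in jJ.
Qed.

Definition noise_mean (phi : R -> R) n : R :=
  phi (theta p n) * p n + phi (tn n) * (1 - p n).

(** Independence is given for events only. Hence the induction on [l] carries a cylinder along: on
    each of the two values of [Z i] the factor [phi i] is constant, and the event that [Z i] takes
    this value joins the cylinder. *)
Lemma noise_moment (phi : nat -> R -> R) (l : seq nat) (J : {fset nat})
    (B : nat -> set R) :
  (forall i, measurable_fun setT (phi i)) -> (forall j, measurable (B j)) ->
  uniq l -> (forall j, j \in l -> j \notin J) ->
  \int[P]_x ((\prod_(i <- l) phi i (Z i x)) * \1_(cylinder J B) x) =
  (\prod_(i <- l) noise_mean (phi i) i) * fine (P (cylinder J B)).
Proof.
move=> mphi; elim: l J B => [|i l IH] J B mB.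
  move=> _ _; rewrite big_nil mul1r.
  under eq_Rintegral => x _ do rewrite big_nil mul1r.
  rewrite /Rintegral integral_indic ?setIT//; exact: measurable_cylinder.
move=> /= /andP[il ul] hlJ.
have iJ : i \notin J by apply: hlJ; rewrite mem_head.
(* [B1 c] adds the constraint [Z i = c], and [F c] is the remaining integrand on the enlarged
   cylinder. *)
pose B1 c j := if j == i then [set c] else B j.
have mB1 c j : measurable (B1 c j) by rewrite /B1; case: eqP.
pose F c x := (\prod_(j <- l) phi j (Z j x)) * \1_(cylinder (i |` J)%fset (B1
  c)) x.
have bF c : ae_bounded P (F c).
  apply: ae_boundedM; last by apply: ae_bounded_indic;
    exact: measurable_cylinder.
  by apply: (@ae_bounded_prod _ _ _ P _ l (fun j x => phi j (Z j x))) => j;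
    exact: ae_bounded_noise.
have intF c : \int[P]_x (F c x) = (\prod_(j <- l) noise_mean (phi j) j) *
    (fine (P (Z i @^-1` [set c])) * fine (P (cylinder J B))).
  rewrite IH//; last first.
    move=> j jl; rewrite in_fset1U negb_or hlJ ?inE ?jl ?orbT// andbT.
    by apply: contraNneq il => <-.
  congr (_ * _); rewrite cylinder_split// probability_cylinder_split//.
  by rewrite fineM//; apply: fin_num_measure;
    [exact: measurable_preimage_Z|exact: measurable_cylinder].
(* Almost surely exactly one of the two summands survives, according to the value of [Z i]. *)
transitivity (\int[P]_x (phi i (theta p i) * F (theta p i) x + phi i (tn i) * F
  (tn i) x)).
  have b1 c : ae_bounded P (fun x => phi i c * F c x).
    exact: ae_boundedM (ae_bounded_cst _ _) (bF c).
  apply: ae_eq_Rintegral.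
  - apply: measurable_funM;
    last by have [] := ae_bounded_indic P (measurable_cylinder J mB).
    by have [] := @ae_bounded_prod _ _ _ P _ (i :: l) (fun j x => phi j (Z j x))
        (fun j => ae_bounded_noise j (mphi j)).
  - by have [] := ae_boundedD (b1 (theta p i)) (b1 (tn i)).
  - apply: filterS (noise_two_valued i) => x Zx.
    rewrite big_cons /F !cylinder_split// !indicE !in_setI.
    have ne := theta_neq i.
    case: Zx => Zx; rewrite Zx.
      rewrite [in X in _ + X](_ : (x \in _ @^-1` [set tn i]) = false);
        last first.
        by apply/negbTE; rewrite notin_setE /= Zx; exact/eqP.
      rewrite (_ : (x \in _ @^-1` [set theta p i]) = true);
        last by rewrite mem_set.
      by rewrite andbF andbT mulr0 mulr0 addr0 mulrA.
    rewrite [in X in X + _](_ : (x \in _ @^-1` [set theta p i]) = false);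
      last first.
      by apply/negbTE; rewrite notin_setE /= Zx => /eqP;
        rewrite eq_sym (negPf ne).
    rewrite (_ : (x \in _ @^-1` [set tn i]) = true); last by rewrite mem_set.
    by rewrite andbF andbT mulr0 mulr0 add0r mulrA.
rewrite RintegralD//; last 2 first.
- apply: (@ae_bounded_integrable1 _ _ _ P (fun x => _ * F _ x)).
  exact: ae_boundedM (ae_bounded_cst _ _) (bF _).
- apply: (@ae_bounded_integrable1 _ _ _ P (fun x => _ * F _ x)).
  exact: ae_boundedM (ae_bounded_cst _ _) (bF _).
rewrite !RintegralZl//; do ?by apply: ae_bounded_integrable1; exact: bF.
rewrite !intF big_cons; have [_ _ Zp Zq _] := hZ.
rewrite (_ : P (Z i @^-1` [set theta p i]) = (p i)%:E)//.
rewrite (_ : P (Z i @^-1` [set tn i]) = (1 - p i)%:E)//=.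
rewrite /noise_mean; ring.
Qed.

End Noise.

(** * Orthonormality *)

Section NoiseBasis.
Context {d : measure_display} {T : measurableType d} {R : realType}.
Variable P : probability T R.
Variables (p : nat -> R) (Z : nat -> {RV P >-> R}).
Hypothesis hZ : bernoulli_noise p Z.
Implicit Types s t : {fset nat}.

Lemma inner_Zbasis_pi s (g : L2fun P) :
  inner (Zbasis Z s) (\pi_(L2 P) g) =
  (\int[P]_x (Zprod Z s x * complex.Re (g x))) +i*
  (\int[P]_x (Zprod Z s x * complex.Im (g x))).
Proof.
rewrite /Zbasis /L2class inner_pi.
(* By [Zprod_sqint], [insubd] does not fall back on its default 0. *)
have h x : insubd (0 : L2fun P) (fun x =>
  (Zprod Z s x)%:C) x = (Zprod Z s x)%:C.
  by rewrite -[L2val _]/(val _) insubdK //; exact: Zprod_sqint hZ s.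
congr Complex; apply: eq_Rintegral => x _; rewrite h conjc_real.
  by rewrite creM mul0r subr0.
by rewrite cimM mul0r addr0.
Qed.

(** The expectation factors over the union of [s] and [t]. An index in both sets gives the second
    moment, q + p = 1; an index in just one gives the mean, theta p - q / theta = 0. Both values
    follow from q = p theta^2. *)
Lemma inner_Zbasis s t : inner (Zbasis Z s) (Zbasis Z t) = (s == t)%:R.
Proof.
rewrite [Zbasis Z t]/Zbasis /L2class inner_Zbasis_pi.
have h x : insubd (0 : L2fun P) (fun x =>
  (Zprod Z t x)%:C) x = (Zprod Z t x)%:C.
  by rewrite -[L2val _]/(val _) insubdK //; exact: Zprod_sqint hZ t.
suff -> : \int[P]_x (Zprod Z s x *
    complex.Re (insubd (0 : L2fun P) (fun x =>
      (Zprod Z t x)%:C) x)) = (s == t)%:R.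
  have -> : \int[P]_x (Zprod Z s x *
      complex.Im (insubd (0 : L2fun P) (fun x => (Zprod Z t x)%:C) x)) = 0.
    by under eq_Rintegral do rewrite h /= mulr0; rewrite /Rintegral integral0.
  by case: (s == t).
pose phi i (y : R) := (if i \in s then y else 1) * (if i \in t then y else 1).
have mphi i : measurable_fun setT (phi i).
  apply: measurable_funM.
    by case: (i \in s); [exact: measurable_id|exact: measurable_cst].
  by case: (i \in t); [exact: measurable_id|exact: measurable_cst].
have Zprod_incl u v x : (u `<=` v)%fset ->
    Zprod Z u x = \prod_(i <- v) (if i \in u then Z i x else 1).
  move=> uv; transitivity (\prod_(i <- u) (if i \in u then Z i x else 1)).
    by apply: eq_big_seq => i ->.
  by apply: big_fset_incl => // i _ /negbTE ->.
(* The cylinder over no coordinate is the whole space, so this is a plain expectation. *)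
have mom := noise_moment hZ mphi (fun _ => @measurableT _ R)
  (fset_uniq (s `|` t)%fset) (fun j _ => negbT (in_fset0 j)).
have cT : cylinder Z fset0 (fun=> setT) = setT.
  by apply/seteqP; split => // x _ j.
rewrite cT (probability_setT P) mulr1 in mom.
transitivity (\int[P]_x
    (\prod_(i <- (s `|` t)%fset) phi i (Z i x) * \1_(setT : set T) x)).
  apply: eq_Rintegral => x _; rewrite h /= indicE in_setT mulr1.
  rewrite /Zprod -/(Zprod Z s x) -/(Zprod Z t x).
  rewrite (Zprod_incl s _ _ (fsubsetUl s t)) (Zprod_incl t _ _ (fsubsetUr s t)).
  by rewrite -big_split.
rewrite mom; have [st|st] := eqVneq s t.
  rewrite big_seq big1// => i; rewrite /noise_mean /phi st fsetUid => it;
    rewrite !it.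
  have t0 := theta_gt0 hZ i; have q := theta_sqr hZ i.
  have -> : theta p i * theta p i * p i = 1 - p i by rewrite -q; ring.
  have -> : - (theta p i)^-1 * - (theta p i)^-1 * (1 - p i) = p i.
    by rewrite -q; field; rewrite gt_eqF.
  by rewrite subrK.
have [k kU k1] : exists2 k, k \in (s `|` t)%fset & (k \in s) != (k \in t).
  apply: contrapT => hn; move/eqP: st; apply; apply/fsetP => k.
  apply/eqP; apply: contrapT => hk; apply: hn; exists k; last exact/negP.
  by rewrite in_fsetU; move: hk; case: (k \in s); case: (k \in t).
rewrite (big_rem k)//= [X in X * _](_ : _ = 0) ?mul0r// /noise_mean /phi.
have t0 := theta_gt0 hZ k; have q := theta_sqr hZ k.
suff : theta p k * p k - (theta p k)^-1 * (1 - p k) = 0.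
  move: k1; case: (k \in s); case: (k \in t) => // _;
  by rewrite ?mulr1 ?mul1r mulNr.
by rewrite -q; field; rewrite gt_eqF.
Qed.

End NoiseBasis.

(** * Totality *)

Section Totality.
Context {d : measure_display} {T : measurableType d} {R : realType}.
Variable P : probability T R.
Variables (p : nat -> R) (Z : nat -> {RV P >-> R}).
Hypothesis hZ : bernoulli_noise p Z.
Implicit Types s t : {fset nat}.

Lemma ae_bounded_Z i : ae_bounded P (Z i).
Proof. exact: (ae_bounded_noise hZ i (phi := id)). Qed.

Lemma ae_bounded_Zprod s : ae_bounded P (Zprod Z s).
Proof. exact: (@ae_bounded_prod _ _ _ P _ s (fun i => Z i) ae_bounded_Z). Qed.

Section orthogonal.
Variable g : T -> R.
Hypothesis ig : P.-integrable setT (EFin \o g).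
Hypothesis g_orth : forall s, \int[P]_x (Zprod Z s x * g x) = 0.

(** Expand one affine factor at a time: its constant term leaves [s] alone and its linear term moves
    [i] from [l] into [s]. As [l] and [s] are disjoint, no square of a [Z i] appears, and the
    process ends at [g_orth]. *)
Lemma orth_affine_prod (a b : nat -> R) (l : seq nat) s :
  uniq l -> (forall j, j \in l -> j \notin s) ->
  \int[P]_x (Zprod Z s x * (\prod_(j <- l) (a j + b j * Z j x)) * g x) = 0.
Proof.
elim: l s => [|i l IH] s.
  by move=> _ _; under eq_Rintegral do rewrite big_nil mulr1; exact: g_orth.
move=> /= /andP[il ul] hs.
have ils : i \notin s by apply: hs; rewrite mem_head.
pose F t x := Zprod Z t x * (\prod_(j <- l) (a j + b j * Z j x)) * g x.
have iF t : P.-integrable setT (fun x => (F t x)%:E).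
  apply: (@ae_bounded_integrable _ _ _ P (fun x => _ * _) g) ig.
  apply: ae_boundedM; first exact: ae_bounded_Zprod.
  apply: (@ae_bounded_prod _ _ _ P _ l (fun j x => a j + b j * Z j x)) => j.
  apply: ae_boundedD; first exact: ae_bounded_cst.
  by apply: ae_boundedM; [exact: ae_bounded_cst|exact: ae_bounded_Z].
transitivity (\int[P]_x (a i * F s x + b i * F (i |` s)%fset x)).
  apply: eq_Rintegral => x _; rewrite big_cons /F.
  have -> : Zprod Z (i |` s)%fset x = Z i x * Zprod Z s x.
    by rewrite /Zprod big_fsetU1.
  ring.
rewrite RintegralD//; do ?exact: integrable_scale (iF _).
have F0 t (ht : forall j, j \in l -> j \notin t) : Rintegral P setT (F t) = 0.
  exact: IH.
rewrite !RintegralZl//; do ?exact: iF.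
transitivity (a i * 0 + b i * 0); last by rewrite !mulr0 addr0.
congr (_ * _ + _ * _); apply: F0 => j jl; last first.
  rewrite in_fset1U negb_or hs ?inE ?jl ?orbT// andbT.
  by apply: contraNneq il => <-.
by apply: hs; rewrite inE jl orbT.
Qed.

Lemma orth_cylinder J B : (forall j, measurable (B j)) ->
  (\int[P]_(x in cylinder Z J B) (g x)%:E = 0)%E.
Proof.
move=> mB; have mC := measurable_cylinder Z J mB.
(* The line with slope [b j] and intercept [a j] takes the values [c1 j] and [c2 j] at the two
   values of [Z j], so along [Z j] it is almost surely the indicator of [B j]. *)
pose c1 j : R := \1_(B j) (theta p j);
  pose c2 j : R := \1_(B j) (- (theta p j)^-1).
pose b j := (c1 j - c2 j) / (theta p j + (theta p j)^-1).
pose a j := c1 j - b j * theta p j.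
have := orth_affine_prod a b (fset_uniq J) (s := fset0) (fun j _ =>
  negbT (in_fset0 j)).
rewrite /Rintegral => /eqP; rewrite fine_eq0; last first.
  apply: integrable_fin_num => //.
  apply: (@ae_bounded_integrable _ _ _ P (fun x => _ * _) g) ig.
  apply: ae_boundedM; first exact: ae_bounded_Zprod.
  apply: (@ae_bounded_prod _ _ _ P _ J (fun j x => a j + b j * Z j x)) => j.
  apply: ae_boundedD; first exact: ae_bounded_cst.
  by apply: ae_boundedM; [exact: ae_bounded_cst|exact: ae_bounded_Z].
move=> /eqP e; rewrite -[RHS]e [LHS]integral_mkcond;
  apply: ae_eq_integral => //.
- exact/(measurable_restrictT _ _).1/measurable_funTS/(measurable_int _ ig).
- apply/measurable_EFinP; apply: measurable_funM;
  last exact/measurable_EFinP/(measurable_int _ ig).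
  apply: measurable_funM; first by have [] := ae_bounded_Zprod fset0.
  apply: measurable_prod => j _; apply: measurable_funD => //.
  by apply: measurable_funM => //; have [] := ae_bounded_Z j.
have hae : \forall x \ae P, forall j, j \in J ->
    a j + b j * Z j x = \1_(B j) (Z j x).
  have : \forall x \ae P, forall j, Z j x = theta p j \/ Z j x = - (theta p
    j)^-1.
    apply/ae_foralln => j; exact: noise_two_valued hZ j.
  apply: filterS => x hx j _; have t0 := theta_gt0 hZ j.
  have tt0 : theta p j + (theta p j)^-1 != 0.
    by rewrite gt_eqF// addr_gt0// invr_gt0.
  case: (hx j) => ->; first by rewrite /a subrK.
  rewrite -/(c2 j) /a.
  have -> : c1 j - b j * theta p j + b j * - (theta p j)^-1 =
    c1 j - b j * (theta p j + (theta p j)^-1) by ring.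
  by rewrite /b divfK// opprB addrC subrK.
apply: filterS hae => x hx _; rewrite patchE.
rewrite (eq_big_seq _ hx) /Zprod big_seq_fset0 mul1r.
case: (boolP (x \in cylinder Z J B)) => [|] xC.
  rewrite big_seq big1 ?mul1r// => j jJ; rewrite indicE mem_set//.
  by move: xC; rewrite inE; apply.
suff -> : \prod_(i <- J) \1_(B i) (Z i x) = 0 :> R by rewrite mul0r.
have [j jJ jB] : exists2 j, j \in J & ~ B j (Z j x).
  apply: contrapT => hn; move/negP: xC; apply; rewrite inE => j /= jJ.
  by apply: contrapT => hj; apply: hn; exists j.
by rewrite (big_rem j)//= indicE memNset// mul0r.
Qed.

(** Pi-lambda argument: cylinders are closed under intersection and generate the sigma-field, while
    the events on which [g] integrates to 0 form a Dynkin system. The closure under complements uses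
    the whole space, itself a cylinder. *)
Lemma orth_measurable E : measurable E -> (\int[P]_(x in E) (g x)%:E = 0)%E.
Proof.
pose G := [set A | exists J B, (forall j : nat, measurable (B j)) /\ A =
  cylinder Z J B].
pose H := [set A : set T | measurable A /\ (\int[P]_(x in A) (g x)%:E = 0)%E].
have mg : measurable_fun setT g by exact/measurable_EFinP/(measurable_int _ ig).
have HT : (\int[P]_x (g x)%:E = 0)%E.
  have <- : cylinder Z fset0 (fun=> setT) = setT by apply/seteqP;
    split => // x _ j.
  by apply: orth_cylinder => j.
have GI : setI_closed G.
  move=> _ _ [J [B [mB ->]]] [K [C [mC ->]]].
  exists (J `|` K)%fset.
  (* Over the union of the index sets, each family must impose nothing outside its own. *)
  exists (fun j => (if j \in J then B j else setT) `&` (if j \in K then C j else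
    setT)).
  split; first by move=> j; apply: measurableI; case: ifP.
  apply/seteqP; split => [x [h1 h2] j /=|x h].
    by rewrite in_fsetU => _; split; case: ifP => // jJ; [exact: h1|exact: h2].
  split => j /= jJ; have := h j; rewrite /= in_fsetU jJ ?orbT => /(_ isT) [].
    by [].
  by [].
have dH : dynkin H.
  split => //.
  - move=> A [mA A0]; split; first exact: measurableC.
    have := HT; rewrite -(setUv A) integral_setU_EFin//.
    + by rewrite A0 add0e.
    + exact: measurableC.
    + by rewrite setUv.
    + by apply/disj_setPS; rewrite setICr.
  - move=> F tF HF; have mF k : measurable (F k) by have [] := HF k.
    split; first exact: bigcup_measurable.
    rewrite integral_bigcup//; last first.
      by apply: integrableS ig => //; exact: bigcup_measurable.
    by rewrite eseries0// => k _ _; have [] := HF k.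
have [_ _ _ _ gen] := hZ.
have GH : G `<=` H.
  move=> _ [J [B [mB ->]]]; split; first exact: measurable_cylinder.
  exact: orth_cylinder.
have sub : @measurable d T `<=` <<s G >>.
  rewrite gen; apply: smallest_sub; first exact: smallest_sigma_algebra.
  move=> A [n _ [B mB <-]]; apply: sub_sigma_algebra.
  exists [fset n]%fset, (fun=> B); split => //.
  apply/seteqP; split => [x [_ h] j /=|x h];
    first by rewrite in_fset1 => /eqP ->.
  by split => //; apply: (h n); rewrite /= in_fset1.
move=> mE; suff : H E by case.
apply: (lambda_system_subset GI ((dynkin_lambda_system _).1 dH) GH) (sub _ mE)
  => //.
Qed.

Lemma orth_ae0 : \forall x \ae P, g x = 0.
Proof.
have h : ae_eq P setT (EFin \o g) (cst 0%E).
  apply: integral_ae_eq => // E _ mE.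
  by rewrite integral0; exact: orth_measurable.
by apply: filterS h => x /(_ I) [].
Qed.

End orthogonal.

(** Since [Zprod] is real, the real and imaginary parts of [x] are orthogonal to it separately. *)
Lemma Zbasis_total (x : L2 P) : (forall s, inner (Zbasis Z s) x = 0) -> x = 0.
Proof.
move: x; apply: L2_ind => g h.
have /andP[g1 g2] := L2valP g.
have iL (f : T -> R) : f \in Lfun P 2%:E -> P.-integrable setT (EFin \o f).
  move=> hf; apply/Lfun1_integrable; apply: Lfun_subset12 hf.
  exact: fin_num_measure.
have r0 : \forall x \ae P, complex.Re (g x) = 0.
  apply: (orth_ae0 (g := fun x => complex.Re (g x))); first exact: iL.
  by move=> s; have := h s; rewrite (inner_Zbasis_pi hZ) => -[].
have i0 : \forall x \ae P, complex.Im (g x) = 0.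
  apply: (orth_ae0 (g := fun x => complex.Im (g x))); first exact: iL.
  by move=> s; have := h s; rewrite (inner_Zbasis_pi hZ) => -[].
have -> : 0 = \pi_(L2 P) 0 by rewrite !piE.
apply/eqP; rewrite piE Quotient.equivE; apply/asboolP.
apply: filterS2 r0 i0 => x rx ix; rewrite subr0.
exact: complex_ext.
Qed.

End Totality.

(** * Fourier coefficients *)

Section SquaredModulus.
Context {R : realType}.
Implicit Types a b : R[i].

Definition csq a : R := complex.Re a ^+ 2 + complex.Im a ^+ 2.

Lemma csq_norm a : complex.Re `|a| ^+ 2 = csq a.
Proof. by rewrite normc_def /= sqr_sqrtr// addr_ge0 ?sqr_ge0. Qed.

Lemma csq_ge0 a : 0 <= csq a. Proof. by rewrite addr_ge0 ?sqr_ge0. Qed.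

Lemma csqM a b : csq (a * b) = csq a * csq b.
Proof. by case: a b => [x y] [z t]; rewrite /csq /=; ring. Qed.

Lemma csq_real (r : R) : csq r%:C = r ^+ 2.
Proof. by rewrite /csq /= expr0n addr0. Qed.

Lemma csq0 : csq (0 : R[i]) = 0.
Proof. by rewrite /csq /= expr0n addr0. Qed.

Lemma csq1 : csq (1 : R[i]) = 1.
Proof. by rewrite /csq /= expr1n expr0n addr0. Qed.

Lemma csq_le0 a : csq a <= 0 -> a = 0.
Proof.
move=> h; have /eqP : csq a = 0 by apply/eqP; rewrite eq_le h csq_ge0.
rewrite paddr_eq0 ?sqr_ge0// !sqrf_eq0 => /andP[/eqP h1 /eqP h2].
exact: complex_ext.
Qed.

Lemma le_of_le_add_geometric (x y C : R) (K : nat) :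
  (forall k, (K <= k)%N -> x <= y + C * (4 ^+ k)^-1) -> x <= y.
Proof.
move=> h; apply/ler_addgt0Pr => e e0.
(* Then 4^k > k > C / e, which makes the error at most [e]. *)
pose k := maxn K (Num.trunc (C / e)).+1.
apply: le_trans (h k (leq_maxl _ _)) _; rewrite lerD2l.
have k0 : (0 : R) < 4 ^+ k by rewrite exprn_gt0.
rewrite ler_pdivrMr//.
have Ce : C / e < (Num.trunc (C / e)).+1%:R by exact: truncnS_gt.
have kk : (Num.trunc (C / e)).+1%:R <= (4 : R) ^+ k.
  rewrite -natrX ler_nat (leq_trans (leq_maxr K _))// -/k.
  by apply: ltnW; apply: ltn_expl.
by rewrite mulrC -ler_pdivrMr//; apply: ltW; exact: lt_le_trans kk.
Qed.

End SquaredModulus.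

(** * Riesz-Fischer theorem and limits in norm *)

Section RieszFischer.
Context {d : measure_display} {T : measurableType d} {R : realType}.
Variable P : probability T R.
Variables (p : nat -> R) (Z : nat -> {RV P >-> R}).
Hypothesis hZ : bernoulli_noise p Z.
Implicit Types (s t : {fset nat}) (x y : L2 P) (l : seq {fset nat}).
Local Notation e := (Zbasis Z).

Lemma sqnormZ a x : sqnorm (a *: x) = csq a * sqnorm x.
Proof.
rewrite /sqnorm innerZl innerZr inner_sqnorm /csq /sqnorm.
by case: a => u v /=; rewrite ?mulr0 ?mul0r; ring.
Qed.

Lemma sqnorm_Zbasis s : sqnorm (e s) = 1.
Proof. by rewrite /sqnorm (inner_Zbasis hZ) eqxx. Qed.

(** Bessel's inequality for one vector: Pythagoras for the projection of [x] on [e s] and the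
    rest. *)
Lemma csq_coef_le s x : csq (inner (e s) x) <= sqnorm x.
Proof.
set c := inner (e s) x.
have o : inner (c *: e s) (x - c *: e s) = 0.
  by rewrite innerZl innerBr innerZr (inner_Zbasis hZ) eqxx mulr1 subrr mulr0.
have := sqnormD_orth o; rewrite addrC subrK => ->.
by rewrite sqnormZ sqnorm_Zbasis mulr1 lerDl sqnorm_ge0.
Qed.

Lemma Zbasis_coef_inj x y : (forall s, inner (e s) x = inner (e s) y) -> x = y.
Proof.
move=> h; apply/subr0_eq; apply: (Zbasis_total hZ) => s.
by rewrite innerBr h subrr.
Qed.

Lemma coef_sum (c : {fset nat} -> R[i]) l t : uniq l ->
  inner (e t) (\sum_(s <- l) c s *: e s) = if t \in l then c t else 0.
Proof.
move=> ul; rewrite inner_sumr.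
under eq_bigr do rewrite innerZr (inner_Zbasis hZ).
case: ifP => [tl|/negbT tl].
  rewrite (bigD1_seq t)//= eqxx mulr1 big1 ?addr0// => s /negbTE st.
  by rewrite eq_sym st mulr0.
rewrite big_seq big1// => s sl; case: eqP => [ts|_]; last by rewrite mulr0.
by rewrite ts sl in tl.
Qed.

Lemma sqnorm_sum (c : {fset nat} -> R[i]) l : uniq l ->
  sqnorm (\sum_(s <- l) c s *: e s) = \sum_(s <- l) csq (c s).
Proof.
elim: l => [|s l IH] /=; first by rewrite !big_nil /sqnorm inner0r.
move=> /andP[sl ul]; rewrite !big_cons sqnormD_orth; last first.
  by rewrite innerZl coef_sum// (negbTE sl) mulr0.
by rewrite sqnormZ sqnorm_Zbasis mulr1 IH.
Qed.

(** Enumerates, without repetition, the finite sets whose codes lie among the n numbers from m on;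
    [pmap] skips the numbers that code no set. *)
Let L m n : seq {fset nat} := pmap (@choice.pickle_inv {fset nat}) (iota m n).

Let L_uniq m n : uniq (L m n).
Proof. by apply: (pmap_uniq (@choice.pickle_invK _)); exact: iota_uniq. Qed.

Let mem_L n t : (@choice.pickle {fset nat} t < n)%N -> t \in L 0 n.
Proof.
by move=> tn; rewrite mem_pmap; apply/mapP;
  exists (@choice.pickle {fset nat} t);
  rewrite ?mem_iota// choice.pickleK_inv.
Qed.

Let L_cat n m : (n <= m)%N -> L 0 m = L 0 n ++ L n (m - n).
Proof. by move=> nm; rewrite -pmap_cat -{2}(add0n n) -iotaD subnKC. Qed.

(** The squared norms [sg n] of the partial sums increase to a supremum. Indices [phi k] at which
    they are within 4^-k of it give a fast Cauchy sequence, whose limit is [y]. *)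
Lemma Riesz_Fischer (c : {fset nat} -> R[i]) (M : R) :
  (forall l, uniq l -> \sum_(s <- l) csq (c s) <= M) ->
  exists y, (forall s, inner (e s) y = c s) /\ sqnorm y <= 2 * M.
Proof.
move=> cM; pose v n := \sum_(s <- L 0 n) c s *: e s.
pose sg n := \sum_(s <- L 0 n) csq (c s).
have vE n m : (n <= m)%N -> sqnorm (v m - v n) = sg m - sg n.
  move=> nm; rewrite /v /sg (L_cat nm) !big_cat /= addrAC subrr add0r.
  by rewrite addrAC subrr add0r sqnorm_sum.
have sg_mono n m : (n <= m)%N -> sg n <= sg m.
  by move=> nm; rewrite -subr_ge0 -vE// sqnorm_ge0.
have sgM : has_sup (range sg).
  split; first by exists (sg 0); exists 0%N.
  by exists M => _ [n _ <-]; exact: cM.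
have sg_sup n : sg n <= sup (range sg).
  by apply: sup_upper_bound => //; exists n.
have /choice[phi hphi] k : exists n, (k <= n)%N /\ sup (range sg) - sg n <= (4
  ^+ k)^-1.
  have k0 : (0 : R) < (4 ^+ k)^-1 by rewrite invr_gt0 exprn_gt0.
  have [_ [n _ <-] hn] := sup_adherent k0 sgM.
  exists (maxn k n); split; first exact: leq_maxl.
  by have := sg_mono _ _ (leq_maxr k n); lra.
have close k n : (phi k <= n)%N -> sqnorm (v n - v (phi k)) <= (4 ^+ k)^-1.
  by move=> kn; rewrite vE//; have [_] := hphi k; have := sg_sup n; lra.
have [y hy] : exists y, forall k, sqnorm (v (phi k) - y) <= 2 * (4 ^+ k)^-1.
  apply: L2_fast_cauchy => k m km.
  (* [phi] need not be monotone; in the reverse order the error is even at most 4^-m. *)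
  have [h|h] := leqP (phi k) (phi m); first exact: close.
  rewrite -sqnormN opprB; apply: le_trans (close m _ (ltnW h)) _.
  by rewrite lef_pV2 ?posrE ?exprn_gt0// ler_weXn2l// ler1n.
exists y; split.
  move=> t; apply/esym/subr0_eq/csq_le0.
  (* Once k exceeds the code of [t], so does [phi k], and the coefficient of [v (phi k)] at [t] is
     exactly [c t]. *)
  apply: (@le_of_le_add_geometric _ _ _ 2 (@choice.pickle {fset nat} t).+1) => k
    tk; rewrite add0r.
  apply: le_trans (hy k); apply: le_trans (csq_coef_le t _).
  rewrite innerBr coef_sum// mem_L//.
  by have [h _] := hphi k; exact: leq_trans tk h.
apply: (@le_of_le_add_geometric _ _ _ 4 0) => k _.
have -> : y = v (phi k) + (y - v (phi k)) by rewrite addrC subrK.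
apply: le_trans (sqnorm_parallelogram _ _) _.
have := hy k; rewrite -sqnormN opprB => h1.
have : sqnorm (v (phi k)) <= M by rewrite sqnorm_sum//; exact: cM.
lra.
Qed.

(** A weak Parseval bound: by totality, the vector that [Riesz_Fischer] builds from the coefficients
    of [x] is [x]. *)
Lemma sqnorm_le_coef x (M : R) :
  (forall l, uniq l -> \sum_(s <- l) csq (inner (e s) x) <= M) ->
  sqnorm x <= 2 * M.
Proof.
move=> /Riesz_Fischer[y [yx yM]].
by rewrite -(Zbasis_coef_inj yx).
Qed.

Lemma L2norm_sqr x : L2norm x ^+ 2 = sqnorm x.
Proof. by rewrite /L2norm sqr_sqrtr// sqnorm_ge0. Qed.

Lemma L2cvgP (v : nat -> L2 P) y : L2cvg v y <->
  (forall ep : R, 0 < ep -> exists N, forall n, (N <= n)%N ->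
    sqnorm (v n - y) <= ep).
Proof.
split.
  move=> /cvgr0Pnorm_le h ep ep0.
  have /h[N _ hN] : 0 < Num.sqrt ep by rewrite sqrtr_gt0.
  exists N => n /hN h1; rewrite -L2norm_sqr -[leRHS](sqr_sqrtr (ltW ep0)).
  rewrite -[L2norm _ ^+ 2]ger0_norm ?sqr_ge0// normrX.
  by rewrite ler_sqr ?nnegrE ?normr_ge0 ?sqrtr_ge0.
move=> h; apply/cvgr0Pnorm_le => ep ep0.
have /h[N hN] : 0 < ep ^+ 2 by rewrite exprn_gt0.
exists N => // n /= /hN; rewrite -L2norm_sqr => h1.
rewrite ger0_norm ?sqrtr_ge0//.
by rewrite -ler_sqr ?nnegrE ?sqrtr_ge0// ltW.
Qed.

(** [L2lim] picks some limit once one exists, so the point is uniqueness: two limits have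
    coefficients that differ by arbitrarily little. *)
Lemma L2limE (v : nat -> L2 P) y : L2cvg v y -> L2lim v = y.
Proof.
move=> vy; have vl : L2cvg v (L2lim v) by rewrite /L2lim;
  exact: (xgetPex 0 (ex_intro _ y vy)).
apply: Zbasis_coef_inj => s; apply/subr0_eq/csq_le0.
apply/ler_addgt0Pr => ep ep0; rewrite add0r.
have ep4 : 0 < ep / 4 by lra.
have [N hN] := (L2cvgP _ _).1 vy _ ep4.
have [N' hN'] := (L2cvgP _ _).1 vl _ ep4.
rewrite -innerBr; apply: le_trans (csq_coef_le _ _) _.
have -> : L2lim v - y = - (v (maxn N N') - L2lim v) + (v (maxn N N') - y).
  by rewrite opprB addrA subrK.
apply: le_trans (sqnorm_parallelogram _ _) _; rewrite sqnormN.
have := hN _ (leq_maxl N N'); have := hN' _ (leq_maxr N N'); lra.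
Qed.

End RieszFischer.

(** * Dominated convergence of diagonal operators *)

Section DiagonalOperators.
Context {d : measure_display} {T : measurableType d} {R : realType}.
Variable P : probability T R.
Variables (p : nat -> R) (Z : nat -> {RV P >-> R}).
Hypothesis hZ : bernoulli_noise p Z.
Implicit Types (s t : {fset nat}) (x y : L2 P) (l : seq {fset nat}).
Local Notation e := (Zbasis Z).

Lemma sum_cvg0_small (I : eqType) (l : seq I) (f : nat -> I -> R) :
  (forall i, f n i @[n --> \oo] --> 0) -> forall ep, 0 < ep ->
  exists N, forall n, (N <= n)%N -> \sum_(i <- l) f n i <= ep.
Proof.
move=> hf; elim: l => [|i l IH] ep ep0.
  by exists 0%N => n _; rewrite big_nil ltW.
have ep2 : 0 < ep / 2 by lra.
have [N hN] := IH _ ep2.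
have [N' _ hN'] := (cvgr0Pnorm_le _).1 (hf i) _ ep2.
exists (maxn N N') => n; rewrite geq_max => /andP[Nn N'n].
rewrite big_cons; have := hN _ Nn; have := hN' _ N'n; have := ler_norm (f n i).
rewrite /=; lra.
Qed.

(** Take [l0] with sum within [ep] of the supremum of all finite sums: terms outside [l0] can then
    add at most [ep]. *)
Lemma finite_sums_tail (f : {fset nat} -> R) (M : R) : (forall s, 0 <= f s) ->
  (forall l, uniq l -> \sum_(s <- l) f s <= M) ->
  forall ep, 0 < ep -> exists2 l0, uniq l0 &
  forall l, uniq l -> \sum_(s <- l | s \notin l0) f s <= ep.
Proof.
move=> f0 fM ep ep0.
pose E := [set r | exists2 l, uniq l & r = \sum_(s <- l) f s].
have hE : has_sup E.
  split; first by exists 0, [::]; rewrite ?big_nil.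
  by exists M => _ [l ul ->]; exact: fM.
have [_ [l0 ul0 ->] h0] := sup_adherent ep0 hE.
exists l0 => // l ul; rewrite -big_filter.
have : \sum_(s <- l0 ++ [seq s <- l | s \notin l0]) f s <= sup E.
  apply: sup_upper_bound => //; exists (l0 ++ [seq s <- l | s \notin l0]) => //.
  rewrite cat_uniq ul0 filter_uniq// andbT; apply/hasPn => s.
  by rewrite mem_filter => /andP[].
rewrite big_cat /=; lra.
Qed.

(** The limit exists by [Riesz_Fischer], since [nu] inherits the bound on [mu]. For the convergence,
    a finite list [l0] carries all but a small part of the dominating sum, and on [l0] the
    multipliers converge termwise. *)
Lemma multiplier_cvg (a : {fset nat} -> R[i]) (C M : R)
    (mu : nat -> {fset nat} -> R) (nu : {fset nat} -> R) (v : nat -> L2 P) :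
  (forall l, uniq l -> \sum_(s <- l) (#|` s|)%:R ^+ 2 * csq (a s) <= M) ->
  (forall n s, 0 <= mu n s <= C * (#|` s|)%:R) ->
  (forall s, mu n s @[n --> \oo] --> nu s) ->
  (forall n s, inner (e s) (v n) = (mu n s)%:C * a s) ->
  exists y, L2cvg v y /\ forall s, inner (e s) y = (nu s)%:C * a s.
Proof.
move=> aM mu_bd mu_nu hv.
have nu_bd s : 0 <= nu s <= C * (#|` s|)%:R.
  rewrite -(cvg_lim (@Rhausdorff R) (mu_nu s)); apply/andP; split.
    apply: limr_ge; first by apply/cvg_ex; exists (nu s).
    by apply: nearW => n; have /andP[] := mu_bd n s.
  apply: limr_le; first by apply/cvg_ex; exists (nu s).
  by apply: nearW => n; have /andP[] := mu_bd n s.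
have sq_le (r C' : R) : 0 <= r <= C' -> r ^+ 2 <= C' ^+ 2.
  by move=> /andP[r0 rC]; rewrite ler_sqr// nnegrE (le_trans r0).
have [y [hy _]] : exists y, (forall s, inner (e s) y = (nu s)%:C * a s) /\
    sqnorm y <= 2 * (C ^+ 2 * M).
  apply: (Riesz_Fischer hZ) => l ul.
  apply: (@le_trans _ _ (\sum_(s <- l) C ^+ 2 * ((#|` s|)%:R ^+ 2 * csq (a
    s)))).
    apply: ler_sum => s _; rewrite csqM csq_real mulrA -exprMn.
    by apply: ler_wpM2r; [exact: csq_ge0|exact: sq_le].
  by rewrite -mulr_sumr ler_wpM2l ?sqr_ge0// aM.
exists y; split => //; apply/L2cvgP => ep ep0.
(* Chosen so that 2 (del + C^2 del) = ep: [del] bounds the part on [l0], C^2 [del] the tail, and the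
   factor 2 is that of [sqnorm_le_coef]. *)
pose del := ep / 2 / (1 + C ^+ 2).
have C1 : 0 < 1 + C ^+ 2 by have := sqr_ge0 C; lra.
have del0 : 0 < del by rewrite /del !divr_gt0.
have [l0 ul0 hl0] := @finite_sums_tail _ M
  (fun s => mulr_ge0 (sqr_ge0 _) (csq_ge0 (a s))) aM _ del0.
have [|N hN] := @sum_cvg0_small _ l0
    (fun n s => (mu n s - nu s) ^+ 2 * csq (a s)) _ _ del0.
  move=> s; have h : mu n s - nu s @[n --> \oo] --> 0.
    by rewrite -(subrr (nu s)); apply: cvgB => //; exact: cvg_cst.
  have := cvgM (cvgM h h) (cvg_cst (csq (a s))); rewrite !mul0r; exact.
exists N => n Nn.
suff : sqnorm (v n - y) <= 2 * (del + C ^+ 2 * del).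
  have : del * (1 + C ^+ 2) = ep / 2 by rewrite /del divfK// gt_eqF.
  rewrite mulrDr mulr1 (mulrC del); lra.
apply: (sqnorm_le_coef hZ) => l ul.
under eq_bigr do rewrite innerBr hv hy -mulrBl -raddfB csqM csq_real.
rewrite (bigID (fun s => s \in l0)) /=; apply: lerD.
  apply: le_trans (hN _ Nn); rewrite -big_filter.
  (* The list [l] may miss members of [l0]; adding their nonnegative terms completes the sum over
     [l0]. *)
  have perm : perm_eq l0 ([seq s <- l | s \in l0] ++ [seq s <- l0 | s \notin
    l]).
    apply: uniq_perm => //.
      rewrite cat_uniq !filter_uniq//= andbT; apply/hasPn => s.
      by rewrite !mem_filter => /andP[/negbTE -> _]; rewrite andbF.
    move=> s; rewrite mem_cat !mem_filter.
    by case: (s \in l0); case: (s \in l).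
  rewrite (perm_big _ perm) big_cat /= lerDl.
  by apply: sumr_ge0 => s _; rewrite mulr_ge0 ?sqr_ge0 ?csq_ge0.
apply: (@le_trans _ _ (\sum_(s <- l | s \notin l0) C ^+ 2 * ((#|` s|)%:R ^+ 2 *
  csq (a s)))).
  apply: ler_sum => s _; rewrite mulrA -exprMn.
  apply: ler_wpM2r; first exact: csq_ge0.
  have /andP[m0 mC] := mu_bd n s; have /andP[n0 nC] := nu_bd s.
  (* Both multipliers lie between 0 and C #(s), hence so does the modulus of their difference. *)
  rewrite -[leLHS]real_normK ?num_real//; apply: sq_le.
  rewrite normr_ge0 ler_norml; lra.
by rewrite -mulr_sumr ler_wpM2l ?sqr_ge0// hl0.
Qed.

End DiagonalOperators.

(** * Weighted number operators *)

Section Eigenvalues.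
Context {R : realType}.
Implicit Types (s t : {fset nat}) (w : nat -> nat -> R) (u : nat -> R).

(* The eigenvalue on [Zbasis Z s] of the n-th partial sum of [Sw w]. *)
Definition Sw_eig w (n : nat) s : R :=
  \sum_(0 <= j < n.+1) \sum_(0 <= k < n.+1)
    w j k * ((k \in s) && (j \notin (s `\ k)%fset))%:R.

(* The eigenvalue on [Zbasis Z s] of the n-th partial sum of [Nu u]. *)
Definition Nu_eig u (n : nat) s : R :=
  \sum_(0 <= k < n.+1) u k * (k \in s)%:R.

Lemma sum_mem_le n s : \sum_(0 <= k < n) (k \in s)%:R <= (#|` s|)%:R :> R.
Proof.
rewrite -natr_sum ler_nat.
have -> : (\sum_(0 <= k < n) (k \in s) = size [seq k <- index_iota 0 n | k \in
  s])%N.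
  by rewrite size_filter -sum1_count [RHS]big_mkcond.
apply: uniq_leq_size; first by rewrite filter_uniq// iota_uniq.
by move=> k; rewrite mem_filter => /andP[].
Qed.

Lemma Nu_eig_bound u n s C : (forall k, 0 <= u k <= C) ->
  0 <= Nu_eig u n s <= C * (#|` s|)%:R.
Proof.
move=> uC; have u0 k : 0 <= u k by have /andP[] := uC k.
have C0 : 0 <= C by have /andP[/le_trans] := uC 0%N; apply.
apply/andP; split; first by apply: sumr_ge0 => k _; rewrite mulr_ge0.
apply: (@le_trans _ _ (\sum_(0 <= k < n.+1) C * (k \in s)%:R)).
  by apply: ler_sum => k _; rewrite ler_wpM2r//; have /andP[] := uC k.
by rewrite -mulr_sumr ler_wpM2l// sum_mem_le.
Qed.

(** Dropping the condition on j leaves, for each k in [s], a partial column sum of [w], which is at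
    most [C]. *)
Lemma Sw_eig_bound w n s C : (forall j k, 0 <= w j k) ->
  (forall n k, \sum_(0 <= j < n) w j k <= C) ->
  0 <= Sw_eig w n s <= C * (#|` s|)%:R.
Proof.
move=> w0 wC.
have C0 : 0 <= C by have := wC 0%N 0%N; rewrite big_geq.
apply/andP; split.
  by apply: sumr_ge0 => j _; apply: sumr_ge0 => k _; rewrite mulr_ge0.
rewrite /Sw_eig exchange_big /=.
apply: (@le_trans _ _ (\sum_(0 <= k < n.+1) C * (k \in s)%:R)).
  apply: ler_sum => k _;
    apply: (@le_trans _ _ (\sum_(0 <= j < n.+1) w j k * (k \in s)%:R)).
    by apply: ler_sum => j _; rewrite ler_wpM2l// ler_nat; case: (k \in s);
      case: (j \notin _).
  by rewrite -mulr_suml ler_wpM2r.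
by rewrite -mulr_sumr ler_wpM2l// sum_mem_le.
Qed.

Lemma Nu_eig_is_cvg u s C : (forall k, 0 <= u k <= C) ->
  cvgn (fun n => Nu_eig u n s).
Proof.
move=> uC; apply: nondecreasing_is_cvgn.
  apply/nondecreasing_seqP => n; rewrite /Nu_eig [leRHS]big_nat_recr//= lerDl.
  by rewrite mulr_ge0//; have /andP[] := uC n.+1.
exists (C * (#|` s|)%:R) => _ [n _ <-].
by have /andP[] := Nu_eig_bound n s uC.
Qed.

Lemma Sw_eig_is_cvg w s C : (forall j k, 0 <= w j k) ->
  (forall n k, \sum_(0 <= j < n) w j k <= C) ->
  cvgn (fun n => Sw_eig w n s).
Proof.
move=> w0 wC; apply: nondecreasing_is_cvgn.
  apply/nondecreasing_seqP => n; rewrite /Sw_eig [leRHS]big_nat_recr//=.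
  apply: ler_wpDr; first by apply: sumr_ge0 => k _; rewrite mulr_ge0.
  by apply: ler_sum => j _; rewrite [leRHS]big_nat_recr//= lerDl mulr_ge0.
exists (C * (#|` s|)%:R) => _ [n _ <-].
by have /andP[] := Sw_eig_bound n s w0 wC.
Qed.

Lemma sum_pick (F : nat -> R) n N : (n < N)%N ->
  \sum_(0 <= k < N) F k * (k == n)%:R = F n.
Proof.
move=> nN; rewrite (bigD1_seq n) ?mem_index_iota ?iota_uniq//= eqxx mulr1.
by rewrite big1 ?addr0// => k /negbTE ->; rewrite mulr0.
Qed.

(** Compare the pairs (j,k) counted at the two sets. Adding [n] creates the pairs with k = n and j
    outside [t], that is, the column sum minus the part of the column over [t]; it destroys the
    pairs with j = n and k in [t]. The bound n <= N puts row and column n within the range. *)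
Lemma Sw_eig_fsetU1 w n t N : n \notin t -> (n <= N)%N ->
  Sw_eig w N (n |` t)%fset =
  Sw_eig w N t - Nu_eig (fun j => w j n) N t - Nu_eig (fun k => w n k) N t
  + \sum_(0 <= j < N.+1) w j n.
Proof.
move=> nt nN; have nN1 : (n < N.+1)%N by [].
(* All single sums become double sums with a Kronecker factor, so that the identity can be checked
   term by term. *)
have -> : Nu_eig (fun k => w n k) N t =
    \sum_(0 <= j < N.+1) \sum_(0 <= k < N.+1) w j k * (k \in t)%:R * (j ==
      n)%:R.
  rewrite exchange_big /=; apply: eq_bigr => k _.
  by rewrite (sum_pick (fun j => w j k * (k \in t)%:R) nN1).
have -> : Nu_eig (fun j => w j n) N t =
    \sum_(0 <= j < N.+1) \sum_(0 <= k < N.+1) w j k * (j \in t)%:R * (k ==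
      n)%:R.
  apply: eq_bigr => j _.
  by rewrite (sum_pick (fun k => w j k * (j \in t)%:R) nN1).
have -> : \sum_(0 <= j < N.+1) w j n =
    \sum_(0 <= j < N.+1) \sum_(0 <= k < N.+1) w j k * (k == n)%:R.
  by apply: eq_bigr => j _; rewrite (sum_pick (w j) nN1).
rewrite /Sw_eig -!sumrB -big_split /=; apply: eq_bigr => j _.
rewrite -!sumrB -big_split /=; apply: eq_bigr => k _.
rewrite !in_fsetD1 !in_fset1U.
have [->|kn] := eqVneq k n.
  rewrite (negbTE nt) /=; have [->|jn] := eqVneq j n;
    first by rewrite ?eqxx (negbTE nt) /=; ring.
  by case: (j \in t) => /=; ring.
have [->|jn] := eqVneq j n; last by case: (k \in t); case: (j != k);
  case: (j \in t) => /=; ring.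
by rewrite (eq_sym n k) kn (negbTE nt); case: (k \in t) => /=; ring.
Qed.

End Eigenvalues.

(** * The operators acting on coefficients *)

Section OperatorCoefficients.
Context {d : measure_display} {T : measurableType d} {R : realType}.
Variable P : probability T R.
Variables (p : nat -> R) (Z : nat -> {RV P >-> R}).
Hypothesis hZ : bernoulli_noise p Z.
Variables D Dadj : nat -> L2 P -> L2 P.
Hypothesis hD : forall k, annihilation Z k (D k).
Hypothesis hDadj : forall k, adjoint_operators (D k) (Dadj k).
Implicit Types (s t : {fset nat}) (x y : L2 P) (l : seq {fset nat}).
Local Notation e := (Zbasis Z).

(** Adjointness moves [Dadj k] onto the basis vector as [D k], whose value there is known. *)
Lemma coef_Dadj k s x :
  inner (e s) (Dadj k x) = (k \in s)%:R * inner (e (s `\ k)%fset) x.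
Proof. by rewrite -hDadj (hD k).2 innerZl conjc_nat. Qed.

Lemma Dadj_Zbasis k s : Dadj k (e s) = (k \notin s)%:R *: e (k |` s)%fset.
Proof.
apply: (Zbasis_coef_inj hZ) => t.
rewrite coef_Dadj innerZr !(inner_Zbasis hZ) -!natrM !mulnb; congr (_%:R);
  congr nat_of_bool.
apply/andP/andP => [[kt /eqP <-]|[ks /eqP ->]].
  by rewrite fsetD1K// eqxx in_fsetD1 eqxx.
by rewrite fset1U1 fsetU1K.
Qed.

Lemma coef_D k s x :
  inner (e s) (D k x) = (k \notin s)%:R * inner (e (k |` s)%fset) x.
Proof. by rewrite innerJ hDadj -innerJ Dadj_Zbasis innerZl conjc_nat. Qed.

Lemma coef_Nu_term k s x :
  inner (e s) (Dadj k (D k x)) = (k \in s)%:R * inner (e s) x.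
Proof.
rewrite coef_Dadj coef_D in_fsetD1 eqxx /= mul1r.
by have [ks|ks] := boolP (k \in s); [rewrite fsetD1K|rewrite !mul0r].
Qed.

(** From the outermost operator inwards, the index set loses k, gains j, loses j and regains k, so
    the term is diagonal; this covers j = k as well. *)
Lemma coef_Sw_term j k s x :
  inner (e s) (Dadj k (D j (Dadj j (D k x)))) =
  ((k \in s) && (j \notin (s `\ k)%fset))%:R * inner (e s) x.
Proof.
rewrite coef_Dadj coef_D coef_Dadj coef_D fset1U1 mul1r.
case: (boolP (k \in s)) => ks; last by rewrite !mul0r.
case: (boolP (j \in (s `\ k)%fset)) => jsk; first by rewrite mul0r mulr0 mul0r.
by rewrite fsetU1K// in_fsetD1 eqxx fsetD1K//= !mul1r.
Qed.

Lemma real_complexM (a b : R) : (a * b)%:C = a%:C * b%:C.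
Proof. exact: rmorphM. Qed.

Lemma real_complex_nat n : (n%:R : R)%:C = n%:R.
Proof. exact: rmorph_nat. Qed.

Lemma real_complex_sum (I : Type) (r : seq I) (F : I -> R) :
  (\sum_(i <- r) F i)%:C = \sum_(i <- r) (F i)%:C.
Proof. exact: rmorph_sum. Qed.

Lemma coef_Nu_sum u n s x :
  inner (e s) (Nu_sum D Dadj u x n) = (Nu_eig u n s)%:C * inner (e s) x.
Proof.
rewrite inner_sumr real_complex_sum mulr_suml; apply: eq_bigr => k _.
by rewrite innerZr coef_Nu_term real_complexM real_complex_nat mulrA.
Qed.

Lemma coef_Sw_sum w n s x :
  inner (e s) (Sw_sum D Dadj w x n) = (Sw_eig w n s)%:C * inner (e s) x.
Proof.
rewrite inner_sumr real_complex_sum mulr_suml; apply: eq_bigr => j _.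
rewrite inner_sumr real_complex_sum mulr_suml; apply: eq_bigr => k _.
by rewrite innerZr coef_Sw_term real_complexM real_complex_nat mulrA.
Qed.

Lemma DomN_bound x : x \in DomN Z -> exists M, forall l, uniq l ->
  \sum_(s <- l) (#|` s|)%:R ^+ 2 * csq (inner (e s) x) <= M.
Proof.
rewrite inE /DomN /=; set S := (X in (X < _)%E) => Soo.
have S0 : (0 <= S)%E.
  by apply: esum_ge0 => s _; rewrite lee_fin mulr_ge0 ?sqr_ge0.
exists (fine S) => l ul; rewrite -lee_fin fineK ?ge0_fin_numE//.
apply: esum_ge; exists [set` l]; first by split => //; exact: finite_seq.
rewrite -fsbig_seq// sumEFin lee_fin.
by apply: ler_sum => s _; rewrite -csq_norm.
Qed.

(* [Dadj n] shifts coefficients from [t] to [n |` t], and (#t + 1)^2 <= 4 (#t)^2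
   unless [t] is empty. *)
Lemma DomN_bound_Dadj n x (M : R) :
  (forall l, uniq l ->
    \sum_(s <- l) (#|` s|)%:R ^+ 2 * csq (inner (e s) x) <= M) ->
  forall l, uniq l ->
  \sum_(s <- l) (#|` s|)%:R ^+ 2 * csq (inner (e s) (Dadj n x)) <=
  4 * M + csq (inner (e fset0) x).
Proof.
move=> xM l ul; pose a s := csq (inner (e s) x).
have a0 s : 0 <= a s by exact: csq_ge0.
(* Only sets containing [n] have a nonzero coefficient, and on these the removal of [n] is
   injective. *)
pose l' := [seq (s `\ n)%fset | s <- [seq s <- l | n \in s]].
have ul' : uniq l'.
  rewrite map_inj_in_uniq ?filter_uniq// => s t.
  rewrite !mem_filter => /andP[ns _] /andP[nt _] st.
  by rewrite -(fsetD1K ns) st fsetD1K.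
apply: (@le_trans _ _ (\sum_(t <- l') (4 * ((#|` t|)%:R ^+ 2 * a t)
    + (t == fset0)%:R * a t))).
  rewrite [leRHS]big_map [leRHS]big_filter [leRHS]big_mkcond /=;
    apply: ler_sum => s _.
  rewrite coef_Dadj csqM; case: ifP => ns; last by rewrite csq0 mul0r mulr0.
  rewrite csq1 mul1r -/(a _) (cardfsD1 n s) ns mulrA -mulrDl.
  apply: ler_wpM2r => //.
  rewrite -cardfs_eq0; case: #|` _| => [|m] /=;
    first by rewrite expr0n mulr0 add0r expr1n.
  rewrite addr0 natrD -(addn1 m) natrD /=.
  have := ler0n R m; nra.
rewrite big_split /= -mulr_sumr; apply: lerD; first by rewrite ler_wpM2l// xM.
case: (boolP (fset0 \in l')) => h.
  rewrite (bigD1_seq fset0)//= ?eqxx mul1r big1 ?addr0// => t /negbTE ->.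
  by rewrite mul0r.
rewrite big_seq big1 => [|t tl]; first exact: csq_ge0; case: eqP => [t0|_];
  last by rewrite mul0r.
by rewrite -t0 tl in h.
Qed.

End OperatorCoefficients.

(** * Real bounds from the summability of the weight *)

Section WeightBounds.
Context {R : realType}.

Lemma partial_sum_cvg (u : nat -> R) : (forall j, 0 <= u j) ->
  (\sum_(0 <= j <oo) (u j)%:E < +oo)%E ->
  \sum_(0 <= j < n.+1) u j @[n --> \oo] --> fine (\sum_(0 <= j <oo) (u j)%:E)%E.
Proof.
move=> u0 uoo.
have S0 : (0 <= \sum_(0 <= j <oo) (u j)%:E)%E.
  by apply: nneseries_ge0 => j _ _; rewrite lee_fin.
rewrite (cvg_shiftS (fun n => \sum_(0 <= j < n) u j)).
have h : (\sum_(0 <= j < n) (u j)%:E)%E @[n --> \oo] -->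
    (fine (\sum_(0 <= j <oo) (u j)%:E)%E)%:E.
  rewrite fineK ?ge0_fin_numE//.
  by apply: is_cvg_nneseries => j _ _; rewrite lee_fin.
rewrite [X in X @ _ --> _](_ : _ = fine \o (fun n =>
  (\sum_(0 <= j < n) (u j)%:E)%E)).
  exact: fine_cvg h.
by apply/funext => n; rewrite /= sumEFin.
Qed.

Lemma weight_column_bound (w : nat -> nat -> R) :
  (forall j k, 0 <= w j k) ->
  (ereal_sup (range (fun k => \sum_(0 <= j <oo) (w j k)%:E)) < +oo)%E ->
  exists C, (forall k, (\sum_(0 <= j <oo) (w j k)%:E <= C%:E)%E) /\
    forall n k, \sum_(0 <= j < n) w j k <= C.
Proof.
move=> w0; set S := ereal_sup _ => Soo.
have kS k : (\sum_(0 <= j <oo) (w j k)%:E <= S)%E.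
  by apply: ereal_sup_ubound; exists k.
have s0 k : (0 <= \sum_(0 <= j <oo) (w j k)%:E)%E.
  by apply: nneseries_ge0 => j _ _; rewrite lee_fin.
have SC : (fine S)%:E = S by rewrite fineK// ge0_fin_numE// (le_trans (s0 0%N)).
exists (fine S); split=> [k|n k]; first by rewrite SC.
rewrite -lee_fin SC -sumEFin; apply: le_trans (kS k).
by apply: nneseries_lim_ge => j _ _; rewrite lee_fin.
Qed.

End WeightBounds.

Unset Implicit Arguments.

Theorem theorem4p11 (d : measure_display) (T : measurableType d)
    (R : realType) (P : probability T R)
    (p : nat -> R) (Z : nat -> {RV P >-> R}) (hZ : bernoulli_noise p Z)
    (D Dadj : nat -> L2 P -> L2 P)
    (hD : forall k, annihilation Z k (D k))
    (hDadj : forall k, adjoint_operators (D k) (Dadj k))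
    (w : nat -> nat -> R) (w_ge0 : forall j k, 0 <= w j k)
    (w_sup : (ereal_sup (range (fun k => \sum_(0 <= j <oo) (w j k)%:E))
              < +oo)%E) :
  forall (n : nat) (xi : L2 P), xi \in DomN Z ->
    [/\ Dadj n xi \in DomS D Dadj w,
        xi \in DomS D Dadj w,
        xi \in DomNu D Dadj (fun j => w j n),
        xi \in DomNu D Dadj (fun k => w n k) &
        Sw D Dadj w (Dadj n xi) =
          Dadj n (Sw D Dadj w xi)
          - Dadj n (Nu D Dadj (fun j => w j n) xi)
          - Dadj n (Nu D Dadj (fun k => w n k) xi)
          + (fine (\sum_(0 <= j <oo) (w j n)%:E))%:C *: Dadj n xi].
Proof.
move=> n xi /DomN_bound[M xiM].
have [C [wC sC]] := weight_column_bound w_ge0 w_sup.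
(* An entry is at most a partial sum of its column, so the row w(n,.) is bounded by [C] as well as
   the column w(.,n). *)
have term_bd j k : 0 <= w j k <= C.
  rewrite w_ge0 /=; apply: le_trans (sC j.+1 k).
  by rewrite big_nat_recr//= lerDr sumr_ge0.
have bN (u : nat -> R) : (forall k, 0 <= u k <= C) ->
    exists y, L2cvg (Nu_sum D Dadj u xi) y /\ forall s,
    inner (Zbasis Z s) y = (limn (fun N =>
      Nu_eig u N s))%:C * inner (Zbasis Z s) xi.
  move=> uC; apply: (multiplier_cvg hZ xiM (fun N s =>
    Nu_eig_bound N s uC)) => [s|N s].
    exact: Nu_eig_is_cvg uC.
  by rewrite (coef_Nu_sum hZ hD hDadj).
have bS (x : L2 P) (M' : R) :
    (forall l : seq {fset nat}, uniq l ->
      \sum_(s <- l) (#|` s|)%:R ^+ 2 * csq (inner (Zbasis Z s) x) <= M') ->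
    exists y, L2cvg (Sw_sum D Dadj w x) y /\ forall s,
    inner (Zbasis Z s) y = (limn (fun N =>
      Sw_eig w N s))%:C * inner (Zbasis Z s) x.
  move=> xM; apply: (multiplier_cvg hZ xM (fun N s =>
    Sw_eig_bound N s w_ge0 sC)) => [s|N s].
    exact: Sw_eig_is_cvg w_ge0 sC.
  by rewrite (coef_Sw_sum hZ hD hDadj).
(* [Dadj n xi] again has a finite weighted coefficient sum, so its image under [Sw] exists too. *)
have [y1 [cy1 hy1]] := bS _ _ (DomN_bound_Dadj hD hDadj n xiM).
have [y2 [cy2 hy2]] := bS _ _ xiM.
have [y3 [cy3 hy3]] := bN (fun j => w j n) (fun j => term_bd j n).
have [y4 [cy4 hy4]] := bN (fun k => w n k) (fun k => term_bd n k).
split.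
- by rewrite inE; exists y1.
- by rewrite inE; exists y2.
- by rewrite inE; exists y3.
- by rewrite inE; exists y4.
rewrite /Sw /Nu (L2limE hZ cy1) (L2limE hZ cy2) (L2limE hZ cy3) (L2limE hZ cy4).
apply: (Zbasis_coef_inj hZ) => s.
rewrite innerDr !innerBr innerZr !(coef_Dadj hD hDadj) hy1 hy2 hy3 hy4.
rewrite (coef_Dadj hD hDadj).
(* Every term is a multiple of a value of [Dadj n] or of its coefficient, so both sides vanish at
   sets without [n]. *)
case: (boolP (n \in s)) => ns; last by rewrite !mul0r !mulr0 !subr0 addr0.
rewrite !mul1r; set t := (s `\ n)%fset; set a := inner _ xi.
rewrite -!mulrBl -mulrDl; congr (_ * a).
rewrite -!raddfB -raddfD /=; congr (_%:C).
have nt : n \notin t by rewrite in_fsetD1 eqxx.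
have cS := @Sw_eig_is_cvg _ w t C w_ge0 sC.
have c1 := @Nu_eig_is_cvg _ _ t C (fun j => term_bd j n).
have c2 := @Nu_eig_is_cvg _ _ t C (fun k => term_bd n k).
have cW := partial_sum_cvg (fun j => w_ge0 j n) (le_lt_trans (wC n) (ltry C)).
apply/cvg_lim => //.
(* The eigenvalue identity holds for partial sums of every rank N >= n, hence for the limits. *)
apply: cvg_trans (cvgD (cvgB (cvgB cS c1) c2) cW).
apply: near_eq_cvg; exists n => // N /= nN.
by rewrite -(fsetD1K ns) -/t Sw_eig_fsetU1.
Qed.
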